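(* Let $A,D\in\mathbb C^{n\times n}$, let $\lambda_0$ be an eigenvalue of $A$ whose largest Jordan block has size $k$, and let $\Xi,\Xi_c,\Sigma,\Sigma_c,s_j,\Xi_{j\ell},\Sigma_{j\ell},\widetilde\Xi_i,\widetilde\Sigma_i,W_i$ be as described in the context. Assume that $W_1,\ldots,W_k$ are all invertible. Let $\rho\in\{1,\ldots,k\}$ be given. Then for all sufficiently small $t>0$ there is a matrix $X=X(t)\in\mathbb C^{n\times \rho s_\rho}$ such that $$(A+tD)X=X(\lambda_0 I+t^{1/\rho}\widehat\Theta_\rho),$$ where $\widehat\Theta_\rho=\widehat\Theta_\rho(t)$ is the matrix defined in the context, which satisfies $\widehat\Theta_\rho=\Theta_\rho+O(t^{1/\rho})$, and $$X=\widetilde\Xi_\rho\begin{bmatrix} I_{s_\rho}&0_{s_\rho\times(\rho-1)s_\rho}\\ G_\rho^{(\rho)}&0_{\hat s_{\rho+1}\times(\rho-1)s_\rho}\end{bmatrix}+\sum_{i=1}^k\Xi_i\widetilde X_i+O(t),$$ with $$\widetilde X_\rho=\mathrm{diag}(0_{s_\rho},\,t^{1/\rho}I_{s_\rho},\,\ldots,\,t^{1-1/\rho}I_{s_\rho}),$$ and, for $i\neq\rho$, $\widetilde X_i$ (an $is_i\times\rho s_\rho$ matrix partitioned into $i$ block rows of height $s_i$, the orders being listed block row by block row) $$\widetilde X_i=O\left(\begin{bmatrix}t^{1-i/\rho}&t^{1-(i-1)/\rho}&\cdots&t^{1-1/\rho}\end{bmatrix}^T\right),\quad 1\le i\le\rho-1,$$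 $$\widetilde X_i=O\left(\begin{bmatrix}t^{1/\rho}&t^{1/\rho}&t^{2/\rho}&\cdots&t^{1-1/\rho}&t&\cdots&t\end{bmatrix}^T\right),\quad \rho+1\le i\le k$$ (that is, for $i>\rho$ the first block row is $O(t^{1/\rho})$ and the $\ell$-th block row, $2\le\ell\le i$, is $O(t^{\min(\ell-1,\rho)/\rho})$).
   Context: Conventions. $I_m$, $0_m$, $0_{m\times p}$ are identity and zero matrices; $B^*$ is the conjugate transpose, $B^{-*}=(B^{-1})^*$; $\Lambda(B)$ is the spectrum. Blocks with zero rows or columns are void. $O(t^c)$, as $t\to0^+$, denotes a matrix whose norm is at most a constant times $t^c$; $O([t^{c_1}\ \cdots\ t^{c_m}]^T)$ denotes a matrix partitioned into $m$ block rows, the $\ell$-th of which is $O(t^{c_\ell})$. Jordan structure. Let $[\Xi\ \ \Xi_c]\in\mathbb C^{n\times n}$ be invertible, $[\Sigma\ \ \Sigma_c]=[\Xi\ \ \Xi_c]^{-*}$, with $A[\Xi\ \ \Xi_c]=[\Xi\ \ \Xi_c]\,\mathrm{diag}(A_{11},A_{22})$, $\lambda_0\notin\Lambda(A_{22})$, $A_{11}=\lambda_0I+N$, $N=\mathrm{diag}(N_1,\ldots,N_k)$, where $N_j$ is the $j\times j$ block matrix with blocks of size $s_j\times s_j$ having $I_{s_j}$ on the first block superdiagonal and zeros elsewhere ($N_1=0_{s_1}$). Here $s_1,\ldots,s_{k-1}\ge0$ and $s_k>0$ are integers, so $A$ has exactly $s_j$ Jordan blocks of size $j$ for $\lambda_0$.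 Partition conformably $\Xi=[\Xi_1\ \cdots\ \Xi_k]$, $\Xi_j=[\Xi_{j1}\ \cdots\ \Xi_{jj}]$, $\Sigma=[\Sigma_1\ \cdots\ \Sigma_k]$, $\Sigma_j=[\Sigma_{j1}\ \cdots\ \Sigma_{jj}]$, where $\Xi_{j\ell},\Sigma_{j\ell}$ have $s_j$ columns. Put $\widetilde\Xi_i=[\Xi_{i1}\ \Xi_{i+1,1}\ \cdots\ \Xi_{k1}]$, $\widetilde\Sigma_i=[\Sigma_{ii}\ \Sigma_{i+1,i+1}\ \cdots\ \Sigma_{kk}]$ and $W_i=\widetilde\Sigma_i^*D\widetilde\Xi_i$, $i=1,\ldots,k$. Put $D_{11}=\Sigma^*D\Xi$, $D_{12}=\Sigma^*D\Xi_c$, $D_{21}=\Sigma_c^*D\Xi$, $D_{22}=\Sigma_c^*D\Xi_c$. Matrices depending on $\rho$. Let $\hat s_{\rho+1}=\sum_{i=\rho+1}^ks_i$. For $j=1,\ldots,\rho$ let $G_j^{(\rho)}=-W_{\rho+1}^{-1}\widetilde\Sigma_{\rho+1}^*D\,\Xi_{j1}\in\mathbb C^{\hat s_{\rho+1}\times s_j}$ (void if $\rho=k$), and $S_\rho=\Sigma_{\rho\rho}^*D\,\Xi_{\rho1}+(\Sigma_{\rho\rho}^*D\,\widetilde\Xi_{\rho+1})G_\rho^{(\rho)}$ (with $S_k=W_k$ if $\rho=k$). $\Theta_\rho$ is the $\rho\times\rho$ block matrix with $s_\rho\times s_\rho$ blocks having $I_{s_\rho}$ on the first block superdiagonal, $S_\rho$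 in block position $(\rho,1)$ and zeros elsewhere ($\Theta_1=S_1$). Definition of $\widehat\Theta_\rho$. Let $P(t)$, for $t$ small, be the solution with $P(t)=O(t)$ of $(A_{22}+tD_{22})P-P(A_{11}+tD_{11})-tPD_{12}P+tD_{21}=0$. Put $z=t^{1/\rho}$. Index the block coordinates of $A_{11}$ by $(i,\ell)$, $1\le i\le k$, $1\le\ell\le i$, each of size $s_i$, in lexicographic order. Let $L$ and $R$ be the block diagonal matrices whose $(i,\ell)$ diagonal blocks are, respectively: $z^{-\ell}I_{s_i}$ and $z^{\ell-1}I_{s_i}$ if $i\le\rho$; $I_{s_i}$ and $I_{s_i}$ if $i>\rho$ and $\ell\le i-\rho$; $z^{-(\ell-i+\rho)}I_{s_i}$ and $z^{\ell-i+\rho-1}I_{s_i}$ if $i>\rho$ and $\ell>i-\rho$. Let $\Pi_L$ be the block row permutation (acting from the left) arranging the block rows in the order: all $(i,\ell)$ with $i\le\rho$ lexicographically; then $(\rho+1,\rho+1),(\rho+2,\rho+2),\ldots,(k,k)$; then all $(i,\ell)$ with $i>\rho$, $\ell<i$ lexicographically. Let $\Pi_R$ be the block column permutation (acting from the right) arranging the block columns in the order: all $(i,\ell)$ with $i\le\rho$ lexicographically; then $(\rho+1,1),(\rho+2,1),\ldots,(k,1)$; then all $(i,\ell)$ with $i>\rho$, $\ell>1$ lexicographically. Let $G$ be the matrix (in the ordering given by $\Pi_R$) equal to the identity plus the blocks $G_j^{(\rho)}$, $j=1,\ldots,\rho$, placed in the block rows $(\rho+1,1),\ldots,(k,1)$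 and block column $(j,1)$. Define $$\widehat U(z)=\Pi_L(zLR)\Pi_RG,\qquad \widehat V(z)=\Pi_LL\big(N+z^\rho(D_{11}+D_{12}P(z^\rho))\big)R\Pi_RG,$$ partitioned $3\times3$ with diagonal blocks of sizes $\sum_{i=1}^{\rho-1}is_i$, $\rho s_\rho$, $\sum_{i=\rho+1}^kis_i$. For $z>0$ small, let $X_1,X_2$ be the solution with $X_1,X_2=O(z)$ of $$\widehat U(z)\begin{bmatrix} X_1 \\ I_{\rho s_\rho} \\ X_2 \end{bmatrix}\widehat\Theta_\rho=\widehat V(z)\begin{bmatrix} X_1 \\ I_{\rho s_\rho} \\ X_2 \end{bmatrix},\qquad\text{where}\quad \widehat\Theta_\rho:=[\,0\ \ I_{\rho s_\rho}\ \ 0\,]\,\widehat V(z)\begin{bmatrix} X_1 \\ I_{\rho s_\rho} \\ X_2 \end{bmatrix}$$ (the middle block row of $\widehat U(z)$ is $[0\ I\ 0]$). This defines $\widehat\Theta_\rho$. *)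

(* Defs.v *)
From HB Require Import structures.
From mathcomp Require Export all_boot all_order all_algebra.
From mathcomp Require Export sesquilinear spectral complex.
From mathcomp Require Export all_classical all_reals all_analysis.

Set Implicit Arguments.
Unset Strict Implicit.
Unset Printing Implicit Defensive.

Export Order.TTheory GRing.Theory Num.Theory.
Export numFieldNormedType.Exports.

Local Open Scope ring_scope.
Local Open Scope classical_set_scope.
Local Open Scope sesquilinear_scope.
Local Open Scope complex_scope.

(* s j is the number of Jordan blocks of size j; only s 1, ..., s k matter.
   Block labels are 1-based, as in (i, l) with 1 <= l <= i <= k, whereas
   ordinals are 0-based, hence the successors below. *)

(* order i s_i of N_i *)
Notation jdim s i := (\sum_(l < i) s i)%N.
(* order of A11 *)
Notation adim s k := (\sum_(i < k) jdim s i.+1)%N.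
(* s_i + s_{i+1} + ... + s_k *)
Notation shat s k i := (\sum_(a < k.+1 - i) s (i + a))%N.

(* Block sizes of U(z) and V(z).  The last of the three groups, formed by the
   labels (i, l) with i > rho, is split in two: first the sizes of the blocks
   (i, i) (rows) resp. (i, 1) (columns), then those of the other i - 1 blocks
   for each i = rho + 1 + a. *)
Notation dim1 s rho := (\sum_(i < rho.-1) jdim s i.+1)%N.
Notation dim2 s rho := (jdim s rho).
Notation dim4 s k rho :=
  (\sum_(a < k - rho) \sum_(c < rho + a) s (rho.+1 + a))%N.
Notation dim3 s k rho := (shat s k rho.+1 + dim4 s k rho)%N.
Notation dimUV s k rho := (dim1 s rho + dim2 s rho + dim3 s k rho)%N.

Section JordanStructure.

Context {C : numClosedFieldType} (s : nat -> nat) (k : nat).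

Definition Nblock (i : nat) : 'M[C]_(jdim s i) :=
  \mxblock_(a < i, b < i) (if b == a.+1 :> nat then 1%:M else 0 : 'M[C]_(s i)).

Definition Nmx : 'M[C]_(adim s k) := \mxdiag_(i < k) Nblock i.+1.

Definition A11 (lambda0 : C) : 'M[C]_(adim s k) := lambda0%:M + Nmx.

(* A family Y of block columns Y_{il} represents the partitioned matrix
   [Y_1 ... Y_k] with Y_i = [Y_{i1} ... Y_{ii}]. *)
Definition blockrow n (Y : forall i l : nat, 'M[C]_(n, s i)) (i : nat) :
    'M[C]_(n, jdim s i) :=
  \mxrow_(l < i) Y i l.+1.

Definition assemble n (Y : forall i l : nat, 'M[C]_(n, s i)) :
    'M[C]_(n, adim s k) :=
  \mxrow_(i < k) blockrow Y i.+1.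

Definition Xitilde n (Xi : forall i l : nat, 'M[C]_(n, s i)) (i : nat) :
    'M[C]_(n, shat s k i) :=
  \mxrow_(a < k.+1 - i) Xi (i + a)%N 1%N.

Definition Sigmatilde n (Sg : forall i l : nat, 'M[C]_(n, s i)) (i : nat) :
    'M[C]_(n, shat s k i) :=
  \mxrow_(a < k.+1 - i) Sg (i + a)%N (i + a)%N.

(* block row (i, l) of the identity matrix partitioned as A11 *)
Definition unit_blockrow (i l : nat) : 'M[C]_(s i, adim s k) :=
  \mxrow_(i' < k) \mxrow_(l' < i'.+1)
    (if (i == i'.+1) && (l == l'.+1) then pid_mx (s i)
     else 0 : 'M[C]_(s i, s i'.+1)).

Section Scaling.

Variable (rho : nat).

Definition PiL : 'M[C]_(dimUV s k rho, adim s k) :=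
  col_mx
    (col_mx (\mxcol_(i < rho.-1) \mxcol_(l < i.+1) unit_blockrow i.+1 l.+1)
            (\mxcol_(l < rho) unit_blockrow rho l.+1))
    (col_mx
       (\mxcol_(a < k.+1 - rho.+1) unit_blockrow (rho.+1 + a) (rho.+1 + a))
       (\mxcol_(a < k - rho) \mxcol_(c < rho + a)
          unit_blockrow (rho.+1 + a) c.+1)).

Definition PiR : 'M[C]_(adim s k, dimUV s k rho) :=
  row_mx
    (row_mx (\mxrow_(i < rho.-1) \mxrow_(l < i.+1) (unit_blockrow i.+1 l.+1)^T)
            (\mxrow_(l < rho) (unit_blockrow rho l.+1)^T))
    (row_mx
       (\mxrow_(a < k.+1 - rho.+1) (unit_blockrow (rho.+1 + a) 1)^T)
       (\mxrow_(a < k - rho) \mxrow_(c < rho + a)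
          (unit_blockrow (rho.+1 + a) c.+2)^T)).

Definition Lentry (z : C) (i l : nat) : C :=
  if (i <= rho)%N then z ^- l
  else if (l <= i - rho)%N then 1
  else z ^- (l - (i - rho)).

Definition Rentry (z : C) (i l : nat) : C :=
  if (i <= rho)%N then z ^+ l.-1
  else if (l <= i - rho)%N then 1
  else z ^+ (l - (i - rho)).-1.

Definition Lmx (z : C) : 'M[C]_(adim s k) :=
  \mxdiag_(i < k) \mxdiag_(l < i.+1) ((Lentry z i.+1 l.+1)%:M : 'M[C]_(s i.+1)).

Definition Rmx (z : C) : 'M[C]_(adim s k) :=
  \mxdiag_(i < k) \mxdiag_(l < i.+1) ((Rentry z i.+1 l.+1)%:M : 'M[C]_(s i.+1)).

End Scaling.

Section Perturbation.

Context (n q : nat) (D : 'M[C]_n) (Xi Sg : forall i l : nat, 'M[C]_(n, s i)).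
Context (Xic Sgc : 'M[C]_(n, q)) (rho : nat).

Definition W (i : nat) : 'M[C]_(shat s k i) :=
  (Sigmatilde Sg i)^t* *m D *m Xitilde Xi i.

Definition D11 : 'M[C]_(adim s k) := (assemble Sg)^t* *m D *m assemble Xi.
Definition D12 : 'M[C]_(adim s k, q) := (assemble Sg)^t* *m D *m Xic.
Definition D21 : 'M[C]_(q, adim s k) := Sgc^t* *m D *m assemble Xi.
Definition D22 : 'M[C]_q := Sgc^t* *m D *m Xic.

Definition Gj (j : nat) : 'M[C]_(shat s k rho.+1, s j) :=
  - (invmx (W rho.+1) *m (Sigmatilde Sg rho.+1)^t* *m D *m Xi j 1%N).

(* For rho = k the matrix Gj rho is void and Smx = W k. *)
Definition Smx : 'M[C]_(s rho) :=
  (Sg rho rho)^t* *m D *m Xi rho 1%N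
  + ((Sg rho rho)^t* *m D *m Xitilde Xi rho.+1) *m Gj rho.

Definition Theta : 'M[C]_(dim2 s rho) :=
  \mxblock_(a < rho, b < rho)
    (if b == a.+1 :> nat then 1%:M
     else if (a.+1 == rho) && (b == 0%N :> nat) then Smx
     else 0).

Definition Gmx : 'M[C]_(dimUV s k rho) :=
  block_mx 1%:M 0
    (col_mx
       (row_mx
          (\mxrow_(i < rho.-1) \mxrow_(l < i.+1)
             (if l == 0%N :> nat then Gj i.+1 else 0))
          (\mxrow_(l < rho) (if l == 0%N :> nat then Gj rho else 0)))
       0)
    1%:M.

Definition Uhat (z : C) : 'M[C]_(dimUV s k rho) :=
  PiL rho *m (z *: (Lmx rho z *m Rmx rho z)) *m PiR rho *m Gmx.

(* The argument P is the value of P(t) at t = z ^ rho. *)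
Definition Vhat (z : C) (P : 'M[C]_(q, adim s k)) : 'M[C]_(dimUV s k rho) :=
  PiL rho *m Lmx rho z *m (Nmx + z ^+ rho *: (D11 + D12 *m P)) *m Rmx rho z
    *m PiR rho *m Gmx.

Definition stack (X1 : 'M[C]_(dim1 s rho, dim2 s rho))
    (X2 : 'M[C]_(dim3 s k rho, dim2 s rho)) :
    'M[C]_(dimUV s k rho, dim2 s rho) :=
  col_mx (col_mx X1 1%:M) X2.

Definition Theta_hat (z : C) (P : 'M[C]_(q, adim s k))
    (X1 : 'M[C]_(dim1 s rho, dim2 s rho))
    (X2 : 'M[C]_(dim3 s k rho, dim2 s rho)) : 'M[C]_(dim2 s rho) :=
  row_mx (row_mx 0 1%:M) 0 *m Vhat z P *m stack X1 X2.

(* [Xi_{rho 1}  Xitilde_{rho+1}] is Xitilde_rho; its splitting makes the block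
   product typecheck. *)
Definition leading_term : 'M[C]_(n, dim2 s rho) :=
  row_mx (Xi rho 1%N) (Xitilde Xi rho.+1)
  *m col_mx (\mxrow_(l < rho) (if l == 0%N :> nat then 1%:M else 0))
            (\mxrow_(l < rho) (if l == 0%N :> nat then Gj rho else 0)).

End Perturbation.

End JordanStructure.

Section Asymptotics.

Context {R : realType}.
Local Notation C := R[i].

(* M(t) = O(t^c) as t -> 0+, for the entrywise maximum norm *)
Definition bigO_pow m p (M : R -> 'M[C]_(m, p)) (c : R) : Prop :=
  exists K : R, \forall t \near 0^'+,
    forall a b, `|M t a b| <= (K * t `^ c)%:C.

Definition is_P (s : nat -> nat) (k n q : nat) (lambda0 : C) (D : 'M[C]_n)
    (Xi Sg : forall i l : nat, 'M[C]_(n, s i)) (Xic Sgc : 'M[C]_(n, q))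
    (A22 : 'M[C]_q) (P : R -> 'M[C]_(q, adim s k)) : Prop :=
  bigO_pow P 1 /\
  \forall t \near 0^'+,
    (A22 + t%:C *: D22 D Xic Sgc) *m P t
    - P t *m (A11 s k lambda0 + t%:C *: D11 k D Xi Sg)
    - t%:C *: (P t *m D12 k D Sg Xic *m P t)
    + t%:C *: D21 k D Xi Sgc = 0.

Definition is_X12 (s : nat -> nat) (k n q rho : nat) (D : 'M[C]_n)
    (Xi Sg : forall i l : nat, 'M[C]_(n, s i)) (Xic : 'M[C]_(n, q))
    (P : R -> 'M[C]_(q, adim s k))
    (X1 : R -> 'M[C]_(dim1 s rho, dim2 s rho))
    (X2 : R -> 'M[C]_(dim3 s k rho, dim2 s rho)) : Prop :=
  [/\ bigO_pow X1 1, bigO_pow X2 1 &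
   \forall z \near 0^'+,
     Uhat k D Xi Sg rho z%:C *m stack (X1 z) (X2 z)
       *m Theta_hat D Xi Sg Xic z%:C (P (z ^+ rho)) (X1 z) (X2 z)
     = Vhat D Xi Sg Xic rho z%:C (P (z ^+ rho)) *m stack (X1 z) (X2 z)].

End Asymptotics.

(* Main.v *)
(* In the basis [Xi Xi_c] the matrix A + tD leaves the range of Xi + Xi_c P(t)
   invariant and acts on it as A11 + tM with M = D11 + D12 P(t).  After scaling
   by L, R and shearing by G, the pencil U(z), V(z) is polynomial in z (up to
   P), hence has a limit at z = 0; there the equation for X1, X2 is solved by
   X1 = 0, X2 = 0 with the value Theta_rho for Theta_hat.  Its linearization
   is injective: the i < rho and the l > 1 blocks form nilpotent chains, and the
   blocks (i, 1), i > rho, are killed by W_{rho+1}.  Both P and X1, X2 are thus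
   obtained from one contraction argument (perturbed_zero).  Theta_rho is
   invertible because S_rho is a Schur complement of W_{rho+1} in W_rho.

   Conversely, let y = PiR G [X1; I; X2] and Y = R y.  The equation for X1, X2
   reads Y_{i,l+1} + t (M Y)_{il} = z Y_{il} Theta_hat, row by row.  This gives
   the invariance, and bootstrapping it upwards from l = i (for i < rho, using
   the invertibility of Theta_hat) or downwards from l = 1 (for i > rho) gives
   the claimed orders of the blocks of Y. *)

Require Import Defs.
From mathcomp Require Import ring lra zify.

Set Implicit Arguments.
Unset Strict Implicit.
Unset Printing Implicit Defensive.
Local Open Scope ring_scope.
Local Open Scope classical_set_scope.
Local Open Scope sesquilinear_scope.
Local Open Scope complex_scope.

(** * Entrywise norm *)

Section EntrywiseNorm.
Context {R : realType}.
Local Notation C := R[i].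

(** [L] contains negative powers of [z], so no limit is taken in [L] alone: only [z L R], [z^rho L],
    [R] and [L N R = N] enter, and their exponents are nonnegative. The equation for [X1], [X2] is
    quadratic, since [Theta_hat] contains them. It is solved for an unconstrained perturbation of
    the whole stack [[0; I; 0]], which makes the linearization an endomorphism, so that injectivity
    already gives invertibility. That the middle block stays the identity is recovered afterwards:
    the middle block row of [U] is [[0 I 0]], and [Theta_hat] is close to the invertible [Theta].
    The shear [G] is chosen so that the columns of [Xi_{rho 1} + Xitilde_{rho+1} G_rho] are
    annihilated by the conjugate transpose of [Sigma_{ii}] times [D], for all [i > rho]. This is
    what makes the zero perturbation satisfy the limit rows [(i, i)], [i > rho]. Fractional powers
    of [t] are kept out of the argument: orders are natural exponents of [z], and [z = t^(1/rho)] is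
    substituted at the end. *)

Definition cabs (x : C) : R := complex.Re `|x|.

Lemma cabsE x : `|x| = (cabs x)%:C.
Proof. by rewrite /cabs RRe_real// normr_real. Qed.

Lemma cabs_ge0 x : 0 <= cabs x.
Proof. by rewrite -lecR -cabsE normr_ge0. Qed.

Lemma cabs0 : cabs 0 = 0.
Proof. by apply: complexI; rewrite -cabsE normr0. Qed.

Lemma cabs_le0 x : cabs x <= 0 -> x = 0.
Proof. by rewrite -lecR -cabsE normr_le0 => /eqP. Qed.

Lemma cabsD x y : cabs (x + y) <= cabs x + cabs y.
Proof. by rewrite -lecR rmorphD/= -!cabsE ler_normD. Qed.

Lemma cabsN x : cabs (- x) = cabs x.
Proof. by rewrite /cabs normrN. Qed.

Lemma cabsM x y : cabs (x * y) = cabs x * cabs y.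
Proof. by apply: complexI; rewrite rmorphM/= -!cabsE normrM. Qed.

Lemma cabs_real (x : R) : 0 <= x -> cabs x%:C = x.
Proof. by move=> x0; apply: complexI; rewrite -cabsE ger0_norm// lecR. Qed.

Lemma cabs_sum (I : Type) (r : seq I) (P : pred I) (F : I -> C) :
  cabs (\sum_(i <- r | P i) F i) <= \sum_(i <- r | P i) cabs (F i).
Proof.
elim/big_ind2 : _ => [|x a y b xa yb|//]; first by rewrite cabs0.
by rewrite (le_trans (cabsD _ _))// lerD.
Qed.

Lemma ge_Re_cabs (x : C) : `|complex.Re x| <= cabs x.
Proof. by rewrite -lecR -cabsE normc_ge_Re. Qed.

Lemma cabs_def (x : C) :
  cabs x = Num.sqrt (complex.Re x ^+ 2 + complex.Im x ^+ 2).
Proof. by apply: complexI; rewrite -cabsE normc_def. Qed.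

Lemma ge_Im_cabs (x : C) : `|complex.Im x| <= cabs x.
Proof. by rewrite cabs_def -sqrtr_sqr ler_wsqrtr// lerDr sqr_ge0. Qed.

Lemma cabs_le_ReIm (x : C) : cabs x <= `|complex.Re x| + `|complex.Im x|.
Proof.
rewrite cabs_def -[leRHS]ger0_norm ?addr_ge0// -sqrtr_sqr ler_wsqrtr//.
rewrite sqrrD !real_normK ?num_real// addrAC lerDl.
by rewrite mulrn_wge0// mulr_ge0.
Qed.

(** Unlike the entrywise maximum, the entry sum is submultiplicative; its values lie in the real
    field [R] rather than in [C]. *)
Definition nrm m p (M : 'M[C]_(m, p)) : R := \sum_a \sum_b cabs (M a b).

Lemma nrm_ge0 m p (M : 'M[C]_(m, p)) : 0 <= nrm M.
Proof. by rewrite sumr_ge0// => a _; rewrite sumr_ge0// => b _; exact: cabs_ge0. Qed.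

Lemma cabs_nrm m p (M : 'M[C]_(m, p)) a b : cabs (M a b) <= nrm M.
Proof.
rewrite /nrm (bigD1 a)//= (bigD1 b)//= -addrA lerDl addr_ge0//.
  by rewrite sumr_ge0// => *; exact: cabs_ge0.
by rewrite sumr_ge0// => ? _; rewrite sumr_ge0// => *; exact: cabs_ge0.
Qed.

Lemma nrm0 m p : nrm (0 : 'M[C]_(m, p)) = 0.
Proof. by rewrite /nrm big1// => a _; rewrite big1// => b _; rewrite mxE cabs0. Qed.

Lemma nrm_le0 m p (M : 'M[C]_(m, p)) : nrm M <= 0 -> M = 0.
Proof.
move=> M0; apply/matrixP => a b; rewrite mxE; apply: cabs_le0.
by rewrite (le_trans (cabs_nrm _ _ _)).
Qed.

Lemma nrmD m p (M N : 'M[C]_(m, p)) : nrm (M + N) <= nrm M + nrm N.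
Proof.
rewrite /nrm -big_split ler_sum// => a _; rewrite -big_split ler_sum// => b _.
by rewrite mxE cabsD.
Qed.

Lemma nrmN m p (M : 'M[C]_(m, p)) : nrm (- M) = nrm M.
Proof. by apply: eq_bigr => a _; apply: eq_bigr => b _; rewrite mxE cabsN. Qed.

Lemma nrmB m p (M N : 'M[C]_(m, p)) : nrm (M - N) <= nrm M + nrm N.
Proof. by rewrite -(nrmN N) nrmD. Qed.

Lemma nrmZ m p a (M : 'M[C]_(m, p)) : nrm (a *: M) = cabs a * nrm M.
Proof.
rewrite /nrm mulr_sumr; apply: eq_bigr => i _; rewrite mulr_sumr.
by apply: eq_bigr => j _; rewrite mxE cabsM.
Qed.

Lemma nrmM m p q (M : 'M[C]_(m, p)) (N : 'M[C]_(p, q)) :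
  nrm (M *m N) <= nrm M * nrm N.
Proof.
rewrite /nrm mulr_suml ler_sum// => a _.
have /le_trans -> // : \sum_b cabs ((M *m N) a b)
    <= \sum_b \sum_j cabs (M a j) * cabs (N j b).
  rewrite ler_sum// => b _; rewrite mxE (le_trans (cabs_sum _ _ _))//.
  by rewrite ler_sum// => j _; rewrite cabsM.
rewrite exchange_big mulr_suml ler_sum//= => j _.
rewrite -mulr_sumr ler_wpM2l ?cabs_ge0// (bigD1 j)//= lerDl.
by rewrite sumr_ge0// => ? _; rewrite sumr_ge0// => *; exact: cabs_ge0.
Qed.

Lemma nrm_sum (I : Type) (r : seq I) (P : pred I) m p (F : I -> 'M[C]_(m, p)) :
  nrm (\sum_(i <- r | P i) F i) <= \sum_(i <- r | P i) nrm (F i).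
Proof.
elim/big_ind2 : _ => [|x a y b xa yb|//]; first by rewrite nrm0.
by rewrite (le_trans (nrmD _ _))// lerD.
Qed.

Lemma linear_bounded m p m' p' (T : {linear 'M[C]_(m, p) -> 'M[C]_(m', p')}) :
  exists2 c : R, 0 <= c & forall X, nrm (T X) <= c * nrm X.
Proof.
exists (\sum_i \sum_j nrm (T (delta_mx i j))).
  by rewrite sumr_ge0// => i _; rewrite sumr_ge0// => j _; exact: nrm_ge0.
move=> X; rewrite {1}(matrix_sum_delta X) linear_sum.
rewrite (le_trans (nrm_sum _ _ _))// mulr_suml ler_sum// => i _.
rewrite linear_sum (le_trans (nrm_sum _ _ _))// mulr_suml ler_sum// => j _.
by rewrite linearZ/= nrmZ mulrC ler_wpM2l ?nrm_ge0// cabs_nrm.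
Qed.

(** In finite dimension a trivial kernel of [lin_mx T] makes this matrix a unit, and its inverse
    gives a right inverse of [T]. *)
Lemma linear_injective_inverse m p
    (T : {linear 'M[C]_(m, p) -> 'M[C]_(m, p)}) :
    (forall X, T X = 0 -> X = 0) ->
  exists Ti : {linear 'M[C]_(m, p) -> 'M[C]_(m, p)}, cancel Ti T.
Proof.
move=> Tinj.
have Tunit : lin_mx T \in unitmx.
  rewrite -row_free_unit -kermx_eq0; apply/eqP/row_matrixP => i.
  rewrite row0; set v := row i _.
  have : v *m lin_mx T = 0 by rewrite /v -row_mul mulmx_ker row0.
  rewrite -(vec_mxK v) mul_vec_lin => /(congr1 vec_mx).
  by rewrite mxvecK linear0 => /Tinj ->; rewrite linear0.
exists (vec_mx \o (mulmxr (invmx (lin_mx T)) \o mxvec)) => Y /=.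
by apply: (can_inj mxvecK); rewrite -mul_vec_lin vec_mxK mulmxKV.
Qed.

End EntrywiseNorm.

(** * Contraction principle for complex matrices *)

Section FixedPoint.
Context {R : realType}.
Local Notation C := R[i].

(** Archimedean property together with [n < 2 ^ n]. It replaces passage to the limit when bounds on
    iterates are transferred to their limit. *)
Lemma le_geometric (a b K : R) :
  (forall n, a <= b + K * 2^-1 ^+ n) -> a <= b.
Proof.
move=> H; rewrite leNgt; apply/negP => ab.
have K0 : 0 < K.
  have := H 0%N; rewrite expr0 mulr1; lra.
set n := Num.bound (K / (a - b)).
have : K / (a - b) < n%:R.
  by apply: le_lt_trans (archi_boundP _); rewrite ?ler_norm// divr_ge0; lra.
have n2 : n%:R <= 2 ^+ n :> R by rewrite -natrX ler_nat ltnW// ltn_expl.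
rewrite ltr_pdivrMr ?subr_gt0// => Kn.
have := H n; rewrite exprVn -lerBlDl ler_pdivlMr ?exprn_gt0// => Hn.
have : (a - b) * n%:R <= (a - b) * 2 ^+ n by rewrite ler_wpM2l//; lra.
lra.
Qed.

(** The intervals with centre [u n] and radius [c / 2 ^ n] are nested, because a step is at most the
    difference of two consecutive radii. The supremum of their left ends lies in all of them. *)
Lemma geometric_cauchy (u : nat -> R) (c : R) :
    (forall n, `|u n.+1 - u n| <= c * 2^-1 ^+ n.+1) ->
  exists l, forall n, `|u n - l| <= c * 2^-1 ^+ n.
Proof.
move=> uc; pose a n := u n - c * 2^-1 ^+ n; pose b n := u n + c * 2^-1 ^+ n.
have ab n : a n <= b n.
  have := uc n; rewrite /a /b exprS.
  have := normr_ge0 (u n.+1 - u n); lra.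
have am : {homo a : n m / (n <= m)%N >-> n <= m}.
  apply: homo_leq => // [? ? ?|n]; first exact: le_trans.
  have := uc n; rewrite /a exprS ler_norml => /andP[]; lra.
have bm : {homo b : n m / (n <= m)%N >-> m <= n}.
  apply: (@homo_leq _ b (fun x y => y <= x)) => // [x y z xy yz|n].
    exact: le_trans yz xy.
  have := uc n; rewrite /b exprS ler_norml => /andP[]; lra.
have ab' n m : a n <= b m.
  rewrite (le_trans (am _ _ (leq_maxl n m)))//.
  by rewrite (le_trans (ab _))// bm// leq_maxr.
exists (sup (range a)) => n; rewrite ler_distlC; apply/andP; split.
  apply: ub_le_sup; last by exists n.
  by exists (b 0%N) => _ [m _ <-].
by apply: ge_sup => [|_ [m _ <-]]; [exists (a 0%N), 0%N|exact: ab'].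
Qed.

Lemma geometric_cauchy_matrix m p (x : nat -> 'M[C]_(m, p)) (c : R) :
    (forall n, nrm (x n.+1 - x n) <= c * 2^-1 ^+ n.+1) ->
  exists X K, forall n, nrm (x n - X) <= K * 2^-1 ^+ n.
Proof.
move=> xc.
have entry a b : exists l : C, forall n, cabs (x n a b - l) <= (c + c) * 2^-1 ^+ n.
  have [|l1 Hl1] := @geometric_cauchy (fun n => complex.Re (x n a b)) c.
    move=> n; rewrite (le_trans _ (xc n))// (le_trans _ (cabs_nrm _ a b))//.
    by rewrite !mxE -raddfB ge_Re_cabs.
  have [|l2 Hl2] := @geometric_cauchy (fun n => complex.Im (x n a b)) c.
    move=> n; rewrite (le_trans _ (xc n))// (le_trans _ (cabs_nrm _ a b))//.
    by rewrite !mxE -raddfB ge_Im_cabs.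
  exists (l1 +i* l2) => n; rewrite (le_trans (cabs_le_ReIm _))// mulrDl.
  by rewrite !raddfB/= lerD.
exists (\matrix_(a, b) sval (cid (entry a b))), (\sum_(a < m) \sum_(b < p) (c + c)) => n.
rewrite mulr_suml ler_sum// => a _; rewrite mulr_suml ler_sum// => b _.
by rewrite !mxE; case: cid.
Qed.

Lemma contraction_fixpoint m p (f : 'M[C]_(m, p) -> 'M[C]_(m, p)) (r : R) :
    0 <= r -> (forall X, nrm X <= r -> nrm (f X) <= r) ->
    (forall X Y, nrm X <= r -> nrm Y <= r ->
       nrm (f X - f Y) <= 2^-1 * nrm (X - Y)) ->
  exists X, nrm X <= r /\ f X = X.
Proof.
move=> r0 fr fc; pose x n := iter n f 0.
have xr n : nrm (x n) <= r by elim: n => [|n]; [rewrite nrm0|exact: fr].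
(* The first step has norm at most [r = 2 * r / 2] and each later one at most half of its
   predecessor, whence the constant [2 * r]. *)
have [|X [K XK]] := @geometric_cauchy_matrix m p x (2 * r).
  move=> n; have -> : 2 * r * 2^-1 ^+ n.+1 = r * 2^-1 ^+ n by rewrite exprS; field.
  elim: n => [|n IHn]; first by rewrite mulr1 subr0 xr.
  by rewrite (le_trans (fc (x n.+1) (x n) _ _))// exprS mulrCA ler_wpM2l.
have Xr : nrm X <= r.
  apply: (@le_geometric _ _ K) => n; have -> : X = x n - (x n - X) by rewrite subKr.
  by rewrite (le_trans (nrmB _ _))// lerD.
exists X; split => //; apply/eqP; rewrite -subr_eq0; apply/eqP/nrm_le0.
apply: (@le_geometric _ _ K) => n.
(* The first term decays geometrically, and the second one does so by the contraction bound applied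
   to [x n] and [X]. *)
have -> : f X - X = (x n.+1 - X) - (f (x n) - f X).
  by rewrite -[x n.+1]/(f (x n)) opprB [RHS]addrC addrA subrK.
rewrite (le_trans (nrmB _ _))//.
have := XK n.+1; have := fc _ _ (xr n) Xr; have := XK n; rewrite exprS.
lra.
Qed.

(* [X |-> X - T^-1 (F z X)] is a contraction of the ball of radius [O(z)]. *)
Lemma perturbed_zero m p (T : {linear 'M[C]_(m, p) -> 'M[C]_(m, p)})
    (F : R -> 'M[C]_(m, p) -> 'M[C]_(m, p)) (c : R) :
    (forall X, T X = 0 -> X = 0) ->
    (\forall z \near 0^'+, nrm (F z 0) <= c * z) ->
    (\forall z \near 0^'+, forall X Y, nrm X <= 1 -> nrm Y <= 1 ->
       nrm (F z X - F z Y - T (X - Y)) <= c * (z + nrm X + nrm Y) * nrm (X - Y)) ->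
  exists (X : R -> 'M[C]_(m, p)) (K : R),
    \forall z \near 0^'+, nrm (X z) <= K * z /\ F z (X z) = 0.
Proof.
move=> Tinj F0 FL; have [Ti TiK] := linear_injective_inverse Tinj.
have [k k0 Hk] := linear_bounded Ti.
(* With this radius [K * z], the value at 0 has norm at most [k * c * z], half the radius; the
   contraction factor 1/2 accounts for the other half. *)
pose K := 2 * k * c.
suff : \forall z \near 0^'+, exists X, nrm X <= K * z /\ F z X = 0.
  move=> Hz; have /choice[X HX] : forall z, exists X,
      (exists X, nrm X <= K * z /\ F z X = 0) -> nrm X <= K * z /\ F z X = 0.
    by move=> z; case: (pselect (exists X, nrm X <= K * z /\ F z X = 0)) => [[X ?]|?];
      [exists X|exists 0].
  by exists X, K; apply: filterS Hz => z; exact: HX.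
(* The first bound keeps the ball inside the unit ball, where the Lipschitz estimate is assumed; the
   second makes the Lipschitz constant at most 1/2. *)
have [e e0 He] : exists2 e : R, 0 < e &
    forall z, 0 < z -> z < e -> `|K| * z <= 1 /\ k * `|c| * (z + 2 * `|K| * z) <= 2^-1.
  pose b := 1 + `|K| + k * `|c| * (1 + 2 * `|K|).
  have b0 : 0 <= k * `|c| * (1 + 2 * `|K|).
    by rewrite mulr_ge0 ?mulr_ge0// addr_ge0// mulr_ge0.
  have b1 : 0 < b by have := normr_ge0 K; rewrite /b; lra.
  exists ((2 * b)^-1) => [|z z0]; first by rewrite invr_gt0 mulr_gt0.
  rewrite -[ltRHS]mul1r ltr_pdivlMr ?mulr_gt0// => zb.
  have zK : 0 <= z * `|K| by rewrite mulr_ge0// ltW.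
  have zk : 0 <= z * (k * `|c| * (1 + 2 * `|K|)) by rewrite mulr_ge0// ltW.
  by rewrite /b in zb; split; lra.
have ze : \forall z \near 0^'+, 0 < z < e.
  by near=> z; apply/andP; split; near: z; [exact: nbhs_right_gt|exact: nbhs_right_lt].
apply: filterS3 ze F0 FL => z /andP[z0 ze] F0 FL.
have [Kz1 Kz2] := He z z0 ze.
have c0 : 0 <= c by rewrite -(pmulr_lge0 _ z0) (le_trans (nrm_ge0 _) F0).
have KE : `|K| = K by rewrite ger0_norm// !mulr_ge0.
rewrite KE ger0_norm// in Kz1 Kz2.
have Kz0 : 0 <= K * z by rewrite !mulr_ge0// ltW.
pose f X := X - Ti (F z X).
have fE X Y : f X - f Y = - Ti (F z X - F z Y - T (X - Y)).
  have TiTK : Ti (T (X - Y)) = X - Y.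
    by apply/eqP; rewrite -subr_eq0; apply/eqP/Tinj; rewrite linearB/= TiK subrr.
  by rewrite !(linearB Ti) TiTK /f !opprB addrACA [RHS]addrACA [- Y + _]addrC.
have flip X Y : nrm X <= K * z -> nrm Y <= K * z ->
    nrm (f X - f Y) <= 2^-1 * nrm (X - Y).
  move=> XK YK; rewrite fE nrmN (le_trans (Hk _))//.
  have := FL X Y (le_trans XK Kz1) (le_trans YK Kz1).
  move=> /(ler_wpM2l k0) /le_trans -> //.
  rewrite !mulrA ler_wpM2r ?nrm_ge0// (le_trans _ Kz2)//.
  rewrite ler_wpM2l ?mulr_ge0//; lra.
have f0 : nrm (f 0) <= 2^-1 * (K * z).
  rewrite /f sub0r nrmN (le_trans (Hk _))//.
  have := ler_wpM2l k0 F0; rewrite /K; lra.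
have fr X : nrm X <= K * z -> nrm (f X) <= K * z.
  move=> XK; have -> : f X = f 0 + (f X - f 0) by rewrite addrC subrK.
  rewrite (le_trans (nrmD _ _))//.
  have := flip X 0 XK; rewrite nrm0 subr0 => /(_ Kz0); lra.
have [X [XK fX]] := contraction_fixpoint Kz0 fr flip.
(* At a fixed point [Ti (F z X) = 0], and [T] undoes [Ti]. *)
exists X; split => //; have := congr1 T (congr1 (fun Y => X - Y) fX).
by rewrite /f subrr linear0 subKr TiK.
Unshelve. all: by end_near.
Qed.

End FixedPoint.

(** * Orders of magnitude *)

Section Order.
Context {R : realType}.
Local Notation C := R[i].

Lemma near0P (Q : R -> Prop) :
  (\forall z \near 0^'+, Q z) <->
  exists2 e : R, 0 < e & forall z, 0 < z -> z < e -> Q z.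
Proof.
split => [/nbhs_ballP[e e0 He]|[e e0 He]].
  exists e => // z z0 ze; apply: He => //.
  by rewrite /ball/= sub0r normrN gtr0_norm.
near=> z; apply: He; near: z; [exact: nbhs_right_gt|exact: nbhs_right_lt].
Unshelve. all: by end_near.
Qed.

Lemma near0_lt (e : R) : 0 < e -> \forall z \near 0^'+, 0 < z < e.
Proof. by move=> e0; apply/near0P; exists e => // z -> ->. Qed.

Lemma near0_root (r : nat) (Q : R -> Prop) : (0 < r)%N ->
  (\forall z \near 0^'+, Q z) -> \forall t \near 0^'+, Q (t `^ r%:R^-1).
Proof.
move=> r0 /near0P[e e0 He]; apply/near0P.
exists (e ^+ r) => [|t t0 te]; first exact: exprn_gt0.
apply: He; first exact: powR_gt0.
have -> : e = (e ^+ r) `^ r%:R^-1.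
  by rewrite -powR_mulrn ?(ltW e0)// -powRrM mulfV ?pnatr_eq0 -?lt0n// powRr1 ?ltW.
by rewrite gt0_ltr_powR ?invr_gt0 ?ltr0n ?nnegrE ?exprn_ge0// ltW.
Qed.

Lemma near0_expr (r : nat) (Q : R -> Prop) : (0 < r)%N ->
  (\forall t \near 0^'+, Q t) -> \forall z \near 0^'+, Q (z ^+ r).
Proof.
move=> r0 /near0P[e e0 He]; apply/near0P.
exists (Num.min e 1) => [|z z0]; first by rewrite lt_min e0 ltr01.
rewrite lt_min => /andP[ze z1]; apply: He; first exact: exprn_gt0.
by rewrite (le_lt_trans _ ze)// ler_iXnr// ltW.
Qed.

(** The variable is [z], the exponent a natural number; [isO_root] converts to real powers of
    [t]. *)
Definition isO m p (f : R -> 'M[C]_(m, p)) (c : nat) : Prop :=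
  exists K : R, \forall z \near 0^'+, nrm (f z) <= K * z ^+ c.

Section isO_theory.
Context {m p : nat}.
Implicit Types (f g : R -> 'M[C]_(m, p)).

Lemma isO_pos f c : isO f c ->
  exists2 K : R, 0 <= K & \forall z \near 0^'+, 0 < z < 1 /\ nrm (f z) <= K * z ^+ c.
Proof.
move=> [K HK]; exists `|K| => //; apply: filterS2 HK (near0_lt ltr01) => z Kz z01.
split=> //; case/andP: z01 => z0 _.
by rewrite (le_trans Kz)// ler_wpM2r ?ler_norm// exprn_ge0// ltW.
Qed.

Lemma isO_near f g c : (\forall z \near 0^'+, f z = g z) -> isO f c -> isO g c.
Proof. by move=> fg [K HK]; exists K; apply: filterS2 fg HK => z ->. Qed.

Lemma isOD f g c : isO f c -> isO g c -> isO (fun z => f z + g z) c.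
Proof.
move=> [K HK] [L HL]; exists (K + L); apply: filterS2 HK HL => z Kz Lz.
by rewrite (le_trans (nrmD _ _))// mulrDl lerD.
Qed.

Lemma isON f c : isO f c -> isO (fun z => - f z) c.
Proof. by move=> [K HK]; exists K; apply: filterS HK => z; rewrite nrmN. Qed.

Lemma isOB f g c : isO f c -> isO g c -> isO (fun z => f z - g z) c.
Proof. by move=> Of Og; exact: isOD Of (isON Og). Qed.

Lemma isO_cst (A : 'M[C]_(m, p)) : isO (fun=> A) 0.
Proof. by exists (nrm A); apply: nearW => z; rewrite mulr1. Qed.

Lemma isO0 c : isO (fun=> 0 : 'M[C]_(m, p)) c.
Proof. by exists 0; apply: nearW => z; rewrite nrm0 mul0r. Qed.

Lemma isO_leq f c d : (d <= c)%N -> isO f c -> isO f d.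
Proof.
move=> dc /isO_pos[K K0 HK]; exists K; apply: filterS HK => z [/andP[z0 z1] Kz].
by rewrite (le_trans Kz)// ler_wpM2l// ler_wiXn2l// ltW.
Qed.

Lemma isOZ f c k : isO f c -> isO (fun z => z%:C ^+ k *: f z) (k + c).
Proof.
move=> /isO_pos[K K0 HK]; exists K; apply: filterS HK => z [/andP[z0 z1] Kz].
rewrite nrmZ -rmorphXn cabs_real ?exprn_ge0 ?(ltW z0)//.
by rewrite exprD mulrCA ler_wpM2l ?exprn_ge0// ltW.
Qed.

Lemma isOZ_inv f c k : isO (fun z => z%:C ^+ k *: f z) (k + c) -> isO f c.
Proof.
move=> /isO_pos[K K0 HK]; exists K; apply: filterS HK => z [/andP[z0 z1]].
rewrite nrmZ -rmorphXn cabs_real ?exprn_ge0 ?(ltW z0)//.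
by rewrite exprD mulrCA ler_pM2l// exprn_gt0.
Qed.

Lemma isO_sum (I : finType) (F : I -> R -> 'M[C]_(m, p)) c :
  (forall i, isO (F i) c) -> isO (fun z => \sum_i F i z) c.
Proof.
move=> HF; suff : forall r : seq I, isO (fun z => \sum_(i <- r) F i z) c by exact.
elim=> [|i r IH]; first by apply: isO_near (isO0 c); near=> z; rewrite big_nil.
by apply: isO_near (isOD (HF i) IH); near=> z; rewrite big_cons.
Unshelve. all: by end_near.
Qed.

End isO_theory.

Lemma isOM m n p (f : R -> 'M[C]_(m, n)) (g : R -> 'M[C]_(n, p)) c d :
  isO f c -> isO g d -> isO (fun z => f z *m g z) (c + d).
Proof.
move=> /isO_pos[K K0 HK] /isO_pos[L L0 HL]; exists (K * L).
apply: filterS2 HK HL => z [/andP[z0 _] Kz] [_ Lz].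
by rewrite (le_trans (nrmM _ _))// exprD mulrACA ler_pM// nrm_ge0.
Qed.

Lemma isOMl m n p (A : 'M[C]_(m, n)) (g : R -> 'M[C]_(n, p)) d :
  isO g d -> isO (fun z => A *m g z) d.
Proof. exact: (isOM (isO_cst A)). Qed.

Lemma isOMr m n p (f : R -> 'M[C]_(m, n)) (A : 'M[C]_(n, p)) d :
  isO f d -> isO (fun z => f z *m A) d.
Proof. by move=> Of; rewrite -(addn0 d); exact: isOM Of (isO_cst A). Qed.

(** Writing [Y A = Y f(z) - Y (f(z) - A)] and multiplying by the inverse of [A], the last term costs
    at most half of [nrm Y] for small [z] and is absorbed on the left; hence the factor 2. The bound
    is uniform in [Y]. *)
Lemma isO_unit m (f : R -> 'M[C]_m) (A : 'M[C]_m) :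
    A \in unitmx -> isO (fun z => f z - A) 1 ->
  exists2 K : R, 0 <= K & \forall z \near 0^'+,
    forall p (Y : 'M[C]_(p, m)), nrm Y <= K * nrm (Y *m f z).
Proof.
move=> uA /isO_pos[K K0 HK]; pose a := nrm (invmx A).
have a0 : 0 <= a by exact: nrm_ge0.
exists (2 * a); first by rewrite mulr_ge0.
have e0 : 0 < (2 * (1 + a * K))^-1 by rewrite invr_gt0 mulr_gt0// ltr_pwDl// mulr_ge0.
apply: filterS2 (near0_lt e0) HK => z /andP[z0 ze] [_ Kz] p Y.
rewrite expr1 in Kz.
have zK : a * (K * z) <= 2^-1.
  move: ze; rewrite -[ltRHS]mul1r ltr_pdivlMr; last by rewrite mulr_gt0// ltr_pwDl// mulr_ge0.
  have : 0 <= z * (a * K) by rewrite !mulr_ge0// ltW.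
  lra.
have YE : Y = (Y *m f z - Y *m (f z - A)) *m invmx A.
  by rewrite mulmxBr subKr mulmxK.
have H : nrm Y <= (nrm (Y *m f z) + nrm Y * (K * z)) * a.
  rewrite {1}YE (le_trans (nrmM _ _))// ler_wpM2r// (le_trans (nrmB _ _))//.
  by rewrite lerD2l (le_trans (nrmM _ _))// ler_wpM2l// nrm_ge0.
have := ler_wpM2l (nrm_ge0 Y) zK; lra.
Qed.

Lemma isO_unit_cancel m p (f : R -> 'M[C]_m) (A : 'M[C]_m) (g : R -> 'M[C]_(p, m)) c :
    A \in unitmx -> isO (fun z => f z - A) 1 ->
  isO (fun z => g z *m f z) c -> isO g c.
Proof.
move=> uA Of [L HL]; have [K K0 HK] := isO_unit uA Of.
exists (K * L); apply: filterS2 HL HK => z Lz Hz.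
by rewrite (le_trans (Hz _ (g z)))// -mulrA ler_wpM2l.
Qed.

Lemma bigO_powP m p (f : R -> 'M[C]_(m, p)) (r : nat) :
  bigO_pow f r%:R <-> isO f r.
Proof.
split=> [[K HK]|[K HK]].
  exists (\sum_(a < m) \sum_(b < p) K).
  apply: filterS2 HK (near0_lt ltr01) => z Kz /andP[z0 _].
  rewrite mulr_suml ler_sum// => a _; rewrite mulr_suml ler_sum// => b _.
  by have := Kz a b; rewrite cabsE lecR powR_mulrn// ltW.
exists K; apply: filterS2 HK (near0_lt ltr01) => z Kz /andP[z0 _] a b.
by rewrite cabsE lecR powR_mulrn ?(ltW z0)// (le_trans (cabs_nrm _ _ _)).
Qed.

Lemma rootK (r : nat) (t : R) : (0 < r)%N -> 0 <= t -> (t `^ r%:R^-1) ^+ r = t.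
Proof.
move=> r0 t0; rewrite -powR_mulrn ?powR_ge0// -powRrM mulVf ?powRr1//.
by rewrite pnatr_eq0 -lt0n.
Qed.

Lemma powR_root (r c : nat) (t : R) : t `^ (c%:R / r%:R) = (t `^ r%:R^-1) ^+ c.
Proof. by rewrite mulrC powRrM powR_mulrn ?powR_ge0. Qed.

Lemma isO_root m p (f : R -> 'M[C]_(m, p)) (r c : nat) : (0 < r)%N ->
  isO f c -> bigO_pow (fun t => f (t `^ r%:R^-1)) (c%:R / r%:R).
Proof.
move=> r0 [K HK]; exists K; have := near0_root r0 HK; apply: filterS => t Kt a b.
by rewrite cabsE lecR powR_root (le_trans (cabs_nrm _ _ _)).
Qed.

Lemma isO_expr m p (f : R -> 'M[C]_(m, p)) (r : nat) : (0 < r)%N ->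
  isO f 1 -> isO (fun z => f (z ^+ r)) r.
Proof.
move=> r0 [K HK]; exists K; have := near0_expr r0 HK; apply: filterS => z.
by rewrite expr1.
Qed.

End Order.

(** * Block rows *)

Section Blocks.
Context {C : numClosedFieldType} (s : nat -> nat) (k : nat).
Local Notation e := (@unit_blockrow C s k).

Definition label (i l : nat) : bool := [&& (0 < l)%N, (l <= i)%N & (i <= k)%N].

Lemma label_ind (Q : nat -> nat -> Prop) :
    (forall (i : 'I_k) (l : 'I_i.+1), Q i.+1 l.+1) ->
  forall i l, label i l -> Q i l.
Proof.
move=> H [|i] [|l] // /and3P[_ li ik].
exact: (H (Ordinal ik) (Ordinal li)).
Qed.

(** Block rows are addressed by natural labels instead of dependent ordinals: [pid_mx] makes the
    definition typecheck for all labels and is the identity at the matching one. *)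
Lemma unit_blockrow_mul p (M : 'M[C]_(adim s k, p)) (i : 'I_k) (l : 'I_i.+1) :
  e i.+1 l.+1 *m M = submxcol (submxcol M i) l.
Proof.
rewrite -{1}(submxcolK M) /unit_blockrow mul_mxrow_mxcol (bigD1 i)//= [X in _ + X]big1.
  rewrite addr0 -{1}(submxcolK (submxcol M i)) mul_mxrow_mxcol (bigD1 l)//= big1.
    by rewrite addr0 !eqxx/= pid_mx_1 mul1mx.
  move=> l' /negPf ll'; rewrite !eqSS eqxx/= (_ : (l == l' :> nat) = false) ?mul0mx//.
  by apply/negbTE; rewrite eq_sym; exact/negbT.
move=> i' /negPf ii'; rewrite -{1}(submxcolK (submxcol M i')) mul_mxrow_mxcol big1//.
move=> l' _; rewrite !eqSS (_ : (i == i' :> nat) = false) ?mul0mx//.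
by apply/negbTE; rewrite eq_sym; exact/negbT.
Qed.

Lemma unit_blockrowP p (M N : 'M[C]_(adim s k, p)) :
  (forall i l, label i l -> e i l *m M = e i l *m N) -> M = N.
Proof.
move=> H; apply/mxcolP => i; apply/mxcolP => l; rewrite -!unit_blockrow_mul.
by apply: H; rewrite /label/= ltn_ord ltn_ord.
Qed.

Lemma unit_blockrow_id i l : label i l -> e i l *m (e i l)^T = 1%:M.
Proof.
move: i l; apply: label_ind => i l; rewrite unit_blockrow_mul.
by rewrite tr_mxrow mxcolK tr_mxrow mxcolK !eqxx/= pid_mx_1 trmx1.
Qed.

Lemma unit_blockrow_ortho i l i' l' : label i l -> (i' != i) || (l' != l) ->
  e i l *m (e i' l')^T = 0.
Proof.
move: i l; apply: label_ind => i l; rewrite unit_blockrow_mul.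
rewrite tr_mxrow mxcolK tr_mxrow mxcolK -negb_and => /negPf ->.
by rewrite trmx0.
Qed.

(** [Lmx] and [Rmx] are convertible to instances of this, with [c] equal to [Lentry rho z] and
    [Rentry rho z]. *)
Definition scalediag (c : nat -> nat -> C) : 'M[C]_(adim s k) :=
  \mxdiag_(i < k) \mxdiag_(l < i.+1) ((c i.+1 l.+1)%:M : 'M[C]_(s i.+1)).

Lemma unit_blockrow_Nmx i l : label i l ->
  e i l *m Nmx s k = if (l < i)%N then e i l.+1 else 0.
Proof.
move: i l; apply: label_ind => i l; rewrite ltnS.
(* At the end of a chain the next label is out of range, so that its block row is zero by definition
   and both cases merge. *)
have -> : (if (l < i)%N then e i.+1 l.+2 else 0) = e i.+1 l.+2.
  case: ltnP => // il; apply/esym; rewrite /unit_blockrow.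
  apply/mxrowP => i'; rewrite submxrow0 mxrowK; apply/mxrowP => l'.
  rewrite submxrow0 mxrowK; case: ifP => // /andP[/eqP[ii'] /eqP[ll']].
  by move: (ltn_ord l') il; rewrite -ll' -ii'; lia.
rewrite /unit_blockrow mul_mxrow_mxdiag; apply: eq_mxrow => i'.
rewrite mul_mxrow_mxblock; apply: eq_mxrow => l'.
case: (eqVneq i.+1 i'.+1) => [ii'|_]; last by rewrite big1// => *; rewrite mul0mx.
have li' : (l < i'.+1)%N by rewrite -ii'.
rewrite (bigD1 (Ordinal li'))//= big1 => [|l2]; last first.
  rewrite -val_eqE/= eqSS eq_sym => /negPf ->; exact: mul0mx.
by rewrite addr0 eqxx eqSS [l' == _ :> nat]eq_sym; case: ifP => _; rewrite ?mulmx1 ?mulmx0.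
Qed.

Lemma mxrowZ (a : C) m q (q_ : 'I_q -> nat) (B : forall j, 'M[C]_(m, q_ j)) :
  a *: \mxrow_j B j = \mxrow_j (a *: B j).
Proof. by apply/matrixP => i j; rewrite !mxE. Qed.

Lemma unit_blockrow_scalediag c i l : label i l ->
  e i l *m scalediag c = c i l *: e i l.
Proof.
move: i l; apply: label_ind => i l; rewrite /unit_blockrow mul_mxrow_mxdiag.
rewrite mxrowZ; apply: eq_mxrow => i'.
rewrite mul_mxrow_mxdiag mxrowZ; apply: eq_mxrow => l'.
case: ifP => [/andP[/eqP ii' /eqP ll']|_]; last by rewrite mul0mx scaler0.
by rewrite mul_mx_scalar (_ : c i.+1 l.+1 = c i'.+1 l'.+1)// ll' ii'.
Qed.

Lemma assemble_mul n p (Y : forall i l : nat, 'M[C]_(n, s i)) (M : 'M[C]_(adim s k, p)) :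
  assemble k Y *m M = \sum_(i < k) \sum_(l < i.+1) Y i.+1 l.+1 *m (e i.+1 l.+1 *m M).
Proof.
rewrite -{1}(submxcolK M) /assemble mul_mxrow_mxcol; apply: eq_bigr => i _.
rewrite -{1}(submxcolK (submxcol M i)) mul_mxrow_mxcol; apply: eq_bigr => l _.
by rewrite unit_blockrow_mul.
Qed.

Lemma unit_blockrow_assemble n (Y : forall i l : nat, 'M[C]_(n, s i)) i l :
  label i l -> e i l *m (assemble k Y)^t* = (Y i l)^t*.
Proof.
move: i l; apply: label_ind => i l; rewrite unit_blockrow_mul.
rewrite -[Y i.+1 l.+1](mxrowK (fun l : 'I_i.+1 => Y i.+1 l.+1)).
rewrite -[\mxrow_l0 _](mxrowK (fun i : 'I_k => blockrow Y i.+1)).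
by apply/matrixP => a b; rewrite !mxE.
Qed.

End Blocks.

(** * The block permutations and the three groups of labels *)

Section Permutations.
Context {C : numClosedFieldType} (s : nat -> nat) (k rho : nat).
Hypothesis rho_range : (1 <= rho <= k)%N.
Local Notation e := (@unit_blockrow C s k).
Local Notation PiL := (@PiL C s k rho).
Local Notation PiR := (@PiR C s k rho).

(** It turns the shape [[X1; I; X2]] into the linear condition [middle *m S = 1]; [stackK] goes
    back. *)
Definition middle : 'M[C]_(dim2 s rho, dimUV s k rho) := row_mx (row_mx 0 1%:M) 0.

Lemma middle_stack (X1 : 'M[C]_(dim1 s rho, dim2 s rho))
    (X2 : 'M[C]_(dim3 s k rho, dim2 s rho)) : middle *m stack X1 X2 = 1%:M.
Proof. by rewrite /middle /stack !mul_row_col !mul0mx mul1mx addr0 add0r. Qed.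

Lemma stackK (S : 'M[C]_(dimUV s k rho, dim2 s rho)) : middle *m S = 1%:M ->
  stack (usubmx (usubmx S)) (dsubmx S) = S.
Proof.
rewrite -{1}(vsubmxK S) -{1}(vsubmxK (usubmx S)) /middle !mul_row_col.
rewrite !mul0mx mul1mx addr0 add0r => S1.
by rewrite /stack -S1 !vsubmxK.
Qed.

Lemma middle_PiL p (M : 'M[C]_(adim s k, p)) :
  middle *m (PiL *m M) = \mxcol_(l < rho) (e rho l.+1 *m M).
Proof.
rewrite /middle /PiL !mul_col_mx !mul_row_col !mul0mx mul1mx addr0 add0r.
by rewrite mxcol_mul.
Qed.

Lemma label_split (i l : nat) : label k i l ->
  [\/ exists (a : 'I_rho.-1) (b : 'I_a.+1), i = a.+1 /\ l = b.+1,
      exists b : 'I_rho, i = rho /\ l = b.+1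
    | exists a : 'I_(k.+1 - rho.+1), i = (rho.+1 + a)%N ].
Proof.
case/and3P; case: l => // l _ li ik; case: (ltngtP i rho) => ir.
- have ir' : (i.-1 < rho.-1)%N by lia.
  have li' : (l < i.-1.+1)%N by lia.
  by constructor 1; exists (Ordinal ir'), (Ordinal li') => /=; split; lia.
- have ir' : (i - rho.+1 < k.+1 - rho.+1)%N by lia.
  by constructor 3; exists (Ordinal ir') => /=; lia.
- have lr : (l < rho)%N by lia.
  by constructor 2; exists (Ordinal lr).
Qed.

(** Every label occurs in the row list: those with [i > rho] appear among the [(i, i)] or among the
    [(i, l)] with [l < i]. This suffices to cancel [PiL] on the left. *)
Lemma PiL_eq0 p (M : 'M[C]_(adim s k, p)) : PiL *m M = 0 -> M = 0.
Proof.
rewrite /PiL !mul_col_mx => /eqP; rewrite !col_mx_eq0 !mxcol_mul.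
move=> /andP[/andP[/eqP M1 /eqP M2] /andP[/eqP M3 /eqP M4]].
apply: unit_blockrowP => i l il; rewrite mulmx0.
case: (label_split il) => [[a [b [-> ->]]]|[b [-> ->]]|[a ia]].
- move/(congr1 (fun A => submxcol (submxcol A a) b)): M1.
  by rewrite mxcolK mxcol_mul mxcolK !submxcol0.
- by move/(congr1 (fun A => submxcol A b)): M2; rewrite mxcolK submxcol0.
subst i; case/and3P: il => l0 lr lk.
case: (ltngtP l (rho.+1 + a)%N) lr => // [lr|->] _.
  have ak : (a < k - rho)%N by case: (a) => /= ?; lia.
  have la : (l.-1 < rho + a)%N by lia.
  move/(congr1 (fun A => submxcol (submxcol A (Ordinal ak)) (Ordinal la))): M4.
  by rewrite mxcolK mxcol_mul mxcolK !submxcol0/= prednK.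
by move/(congr1 (fun A => submxcol A a)): M3; rewrite mxcolK submxcol0.
Qed.

Lemma PiL_inj p (M N : 'M[C]_(adim s k, p)) : PiL *m M = PiL *m N -> M = N.
Proof.
move/eqP; rewrite -subr_eq0 -mulmxBr => /eqP/PiL_eq0/eqP.
by rewrite subr_eq0 => /eqP.
Qed.

Section Coordinates.
Context {p : nat} (T1 : 'M[C]_(dim1 s rho, p)) (T2 : 'M[C]_(dim2 s rho, p))
  (T3 : 'M[C]_(shat s k rho.+1, p)) (T4 : 'M[C]_(dim4 s k rho, p)).

Let T : 'M[C]_(dimUV s k rho, p) := col_mx (col_mx T1 T2) (col_mx T3 T4).

Lemma PiR_mul : PiR *m T =
  (\sum_(i < rho.-1) \sum_(l < i.+1)
     (e i.+1 l.+1)^T *m submxcol (submxcol T1 i) l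
   + \sum_(l < rho) (e rho l.+1)^T *m submxcol T2 l)
  + (\sum_(a < k.+1 - rho.+1) (e (rho.+1 + a) 1)^T *m submxcol T3 a
     + \sum_(a < k - rho) \sum_(c < rho + a)
         (e (rho.+1 + a) c.+2)^T *m submxcol (submxcol T4 a) c).
Proof.
rewrite /PiR !mul_row_col -{1}(submxcolK T1) -{1}(submxcolK T2).
rewrite -{1}(submxcolK T3) -{1}(submxcolK T4) !mul_mxrow_mxcol.
congr (_ + _ + (_ + _)); apply: eq_bigr => i _.
  by rewrite -{1}(submxcolK (submxcol T1 i)) mul_mxrow_mxcol.
by rewrite -{1}(submxcolK (submxcol T4 i)) mul_mxrow_mxcol.
Qed.

Let ortho i l i' l' (M : 'M[C]_(s i', p)) :
  label k i l -> (i' != i) || (l' != l) -> e i l *m ((e i' l')^T *m M) = 0.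
Proof. by move=> il n; rewrite mulmxA unit_blockrow_ortho// mul0mx. Qed.

Let same i l (M : 'M[C]_(s i, p)) : label k i l -> e i l *m ((e i l)^T *m M) = M.
Proof. by move=> il; rewrite mulmxA unit_blockrow_id// mul1mx. Qed.

Lemma PiR_lt (i : 'I_rho.-1) (l : 'I_i.+1) :
  e i.+1 l.+1 *m (PiR *m T) = submxcol (submxcol T1 i) l.
Proof.
have ir : (i.+1 < rho)%N by case: (i) => /= ?; lia.
have il : label k i.+1 l.+1 by rewrite /label; have := ltn_ord l; lia.
rewrite PiR_mul !mulmxDr !mulmx_sumr [X in _ + X + _]big1 => [|c _]; last first.
  by apply: ortho => //; lia.
rewrite [X in _ + (X + _)]big1 => [|c _]; last by apply: ortho => //; lia.
rewrite [X in _ + (_ + X)]big1 => [|c _]; last first.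
  by rewrite mulmx_sumr big1// => d _; apply: ortho => //; lia.
rewrite !addr0 (bigD1 i)//= [X in _ + X]big1 => [|c ci]; last first.
  by rewrite mulmx_sumr big1// => d _; apply: ortho => //; rewrite -val_eqE/= in ci; lia.
rewrite addr0 mulmx_sumr (bigD1 l)//= [X in _ + X]big1 => [|c ci]; last first.
  by apply: ortho => //; rewrite -val_eqE/= in ci; lia.
by rewrite addr0 same.
Qed.

Lemma PiR_eq (l : 'I_rho) : e rho l.+1 *m (PiR *m T) = submxcol T2 l.
Proof.
have il : label k rho l.+1 by rewrite /label; have := ltn_ord l; lia.
rewrite PiR_mul !mulmxDr !mulmx_sumr [X in X + _ + _]big1 => [|c _]; last first.
  rewrite mulmx_sumr big1// => d _; apply: ortho => //; have := ltn_ord c; lia.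
rewrite [X in _ + (X + _)]big1 => [|c _]; last by apply: ortho => //; lia.
rewrite [X in _ + (_ + X)]big1 => [|c _]; last first.
  by rewrite mulmx_sumr big1// => d _; apply: ortho => //; lia.
rewrite !addr0 add0r (bigD1 l)//= [X in _ + X]big1 => [|c ci]; last first.
  by apply: ortho => //; rewrite -val_eqE/= in ci; lia.
by rewrite addr0 same.
Qed.

Lemma PiR_first (a : 'I_(k.+1 - rho.+1)) :
  e (rho.+1 + a) 1 *m (PiR *m T) = submxcol T3 a.
Proof.
have il : label k (rho.+1 + a) 1 by rewrite /label; have := ltn_ord a; lia.
rewrite PiR_mul !mulmxDr !mulmx_sumr [X in X + _ + _]big1 => [|c _]; last first.
  rewrite mulmx_sumr big1// => d _; apply: ortho => //; have := ltn_ord c; lia.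
rewrite [X in _ + X + _]big1 => [|c _]; last by apply: ortho => //; lia.
rewrite [X in _ + (_ + X)]big1 => [|c _]; last first.
  by rewrite mulmx_sumr big1// => d _; apply: ortho => //; lia.
rewrite !addr0 !add0r (bigD1 a)//= [X in _ + X]big1 => [|c ci]; last first.
  by apply: ortho => //; rewrite -val_eqE/= in ci; lia.
by rewrite addr0 same.
Qed.

Lemma PiR_rest (a : 'I_(k - rho)) (c : 'I_(rho + a)) :
  e (rho.+1 + a) c.+2 *m (PiR *m T) = submxcol (submxcol T4 a) c.
Proof.
have il : label k (rho.+1 + a) c.+2.
  by rewrite /label; have := ltn_ord a; have := ltn_ord c; lia.
rewrite PiR_mul !mulmxDr !mulmx_sumr [X in X + _ + _]big1 => [|b _]; last first.
  rewrite mulmx_sumr big1// => d _; apply: ortho => //; have := ltn_ord b; lia.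
rewrite [X in _ + X + _]big1 => [|b _]; last by apply: ortho => //; lia.
rewrite [X in _ + (X + _)]big1 => [|b _]; last by apply: ortho => //; lia.
rewrite !add0r (bigD1 a)//= [X in _ + X]big1 => [|b ba]; last first.
  by rewrite mulmx_sumr big1// => d _; apply: ortho => //; rewrite -val_eqE/= in ba; lia.
rewrite addr0 mulmx_sumr (bigD1 c)//= [X in _ + X]big1 => [|b bc]; last first.
  by apply: ortho => //; rewrite -val_eqE/= in bc; lia.
by rewrite addr0 same.
Qed.

End Coordinates.
End Permutations.

Lemma sum_ord_pred (V : nmodType) (n : nat) (F : nat -> V) : (0 < n)%N ->
  \sum_(j < n) F j = \sum_(j < n.-1) F j + F n.-1.
Proof. by case: n => // n _; rewrite big_ord_recr. Qed.

(** * Coordinates after the shear by G *)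

Section ShearedCoordinates.
Context {C : numClosedFieldType} (s : nat -> nat) (k rho n : nat).
Hypothesis rho_range : (1 <= rho <= k)%N.
Context (D : 'M[C]_n) (Xi Sg : forall i l : nat, 'M[C]_(n, s i)).
Local Notation e := (@unit_blockrow C s k).
Local Notation PiL := (@PiL C s k rho).
Local Notation PiR := (@PiR C s k rho).
Local Notation G := (Gj k D Xi Sg rho).
Local Notation Gmx := (Gmx k D Xi Sg rho).

(** What the shear adds to the blocks [(i, 1)], [i > rho]. It reads only the blocks [(j, 1)] with
    [j <= rho], which the shear leaves alone, so it may be evaluated on the sheared vector
    itself. *)
Definition Gsum p (y : 'M[C]_(adim s k, p)) : 'M[C]_(shat s k rho.+1, p) :=
  \sum_(j < rho) G j.+1 *m (e j.+1 1 *m y).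

Section Coordinates.
Context {p : nat} (T1 : 'M[C]_(dim1 s rho, p)) (T2 : 'M[C]_(dim2 s rho, p))
  (T3 : 'M[C]_(shat s k rho.+1, p)) (T4 : 'M[C]_(dim4 s k rho, p)).

Let T : 'M[C]_(dimUV s k rho, p) := col_mx (col_mx T1 T2) (col_mx T3 T4).

Lemma Gmx_mul :
  Gmx *m T = col_mx (col_mx T1 T2) (col_mx (T3 + Gsum (PiR *m (Gmx *m T))) T4).
Proof.
have GT : Gmx *m T = col_mx (col_mx T1 T2) (col_mx (T3 +
    ((\sum_(i < rho.-1) G i.+1 *m submxcol (submxcol T1 i) ord0) +
     \sum_(l < rho | l == 0%N :> nat) G rho *m submxcol T2 l)) T4).
  rewrite /T /Gmx mul_block_col mul1mx mul0mx addr0 mul1mx mul_col_mx mul0mx.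
  rewrite add_col_mx add0r addrC mul_row_col; congr (col_mx _ (col_mx (_ + (_ + _)) _)).
    rewrite -{1}(submxcolK T1) mul_mxrow_mxcol; apply: eq_bigr => i _.
    rewrite -{1}(submxcolK (submxcol T1 i)) mul_mxrow_mxcol big_ord_recl/=.
    by rewrite [X in _ + X]big1 ?addr0// => l _; rewrite mul0mx.
  rewrite -{1}(submxcolK T2) mul_mxrow_mxcol [RHS]big_mkcond; apply: eq_bigr => l _.
  by case: ifP => _; rewrite ?mul0mx.
rewrite GT; congr (col_mx _ (col_mx (_ + _) _)).
have rho_gt0 : (0 < rho)%N by case/andP: rho_range.
rewrite /Gsum (@sum_ord_pred _ _ (fun j => G j.+1 *m (e j.+1 1 *m _)))// prednK//.
congr (_ + _).
  apply: eq_bigr => i _; congr (_ *m _); apply/esym.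
  exact: (PiR_lt rho_range _ _ _ _ (ord0 : 'I_i.+1)).
rewrite (PiR_eq rho_range _ _ _ _ (Ordinal rho_gt0)).
rewrite (bigD1 (Ordinal rho_gt0))//= [X in _ + X]big1 ?addr0// => l.
by case/andP => /eqP l0 /eqP[]; apply: val_inj.
Qed.

Let y := PiR *m (Gmx *m T).

Lemma coord_lt (i : 'I_rho.-1) (l : 'I_i.+1) :
  e i.+1 l.+1 *m y = submxcol (submxcol T1 i) l.
Proof. by rewrite /y Gmx_mul PiR_lt. Qed.

Lemma coord_eq (l : 'I_rho) : e rho l.+1 *m y = submxcol T2 l.
Proof. by rewrite /y Gmx_mul PiR_eq. Qed.

Lemma coord_first (a : 'I_(k.+1 - rho.+1)) :
  e (rho.+1 + a) 1 *m y = submxcol (T3 + Gsum y) a.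
Proof. by rewrite {1}/y Gmx_mul PiR_first. Qed.

Lemma coord_rest (a : 'I_(k - rho)) (c : 'I_(rho + a)) :
  e (rho.+1 + a) c.+2 *m y = submxcol (submxcol T4 a) c.
Proof. by rewrite /y Gmx_mul PiR_rest. Qed.

End Coordinates.

Lemma middle_coord p (S : 'M[C]_(dimUV s k rho, p)) :
  middle s k rho *m S = \mxcol_(l < rho) (e rho l.+1 *m (PiR *m (Gmx *m S))).
Proof.
rewrite -(vsubmxK S) -(vsubmxK (usubmx S)) -(vsubmxK (dsubmx S)).
rewrite /middle !mul_row_col !mul0mx mul1mx addr0 add0r.
rewrite -[LHS]submxcolK; apply: eq_mxcol => l; rewrite coord_eq//.
Qed.

Lemma PiR_Gmx_eq0 p (S : 'M[C]_(dimUV s k rho, p)) : PiR *m (Gmx *m S) = 0 -> S = 0.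
Proof.
rewrite -(vsubmxK S) -(vsubmxK (usubmx S)) -(vsubmxK (dsubmx S)).
move: (usubmx (usubmx S)) (dsubmx (usubmx S)) (usubmx (dsubmx S)) (dsubmx (dsubmx S)).
move=> T1 T2 T3 T4 y0.
have Gs0 : Gsum (PiR *m (Gmx *m col_mx (col_mx T1 T2) (col_mx T3 T4))) = 0.
  by rewrite y0; apply: big1 => j _; rewrite !mulmx0.
have T10 : T1 = 0.
  apply/mxcolP => i; apply/mxcolP => l.
  by rewrite -(coord_lt T1 T2 T3 T4) y0 mulmx0 !submxcol0.
have T20 : T2 = 0.
  by apply/mxcolP => l; rewrite -(coord_eq T1 T2 T3 T4) y0 mulmx0 submxcol0.
have T30 : T3 = 0.
  apply/mxcolP => a; rewrite -[T3]addr0 -{1}Gs0 -(coord_first T1 T2 T3 T4).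
  by rewrite y0 mulmx0 submxcol0.
have T40 : T4 = 0.
  apply/mxcolP => a; apply/mxcolP => c.
  by rewrite -(coord_rest T1 T2 T3 T4) y0 mulmx0 !submxcol0.
by rewrite T10 T20 T30 T40 !col_mx0.
Qed.

Definition stack0 : 'M[C]_(dimUV s k rho, dim2 s rho) := stack 0 0.

Local Notation y0 := (PiR *m (Gmx *m stack0)).

Definition id_blockrow (l : 'I_rho) : 'M[C]_(s rho, dim2 s rho) := submxcol 1%:M l.

Let stack0E : stack0 = col_mx (col_mx 0 1%:M) (col_mx 0 0).
Proof. by rewrite /stack0 /stack col_mx0. Qed.

Lemma y0_lt i l : label k i l -> (i < rho)%N -> e i l *m y0 = 0.
Proof.
move=> il; case: (label_split rho_range il) => [[a [b [-> ->]]]|[b [-> ->]]|[a ->]]; try lia.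
by move=> _; rewrite stack0E coord_lt !submxcol0.
Qed.

Lemma y0_eq (l : 'I_rho) : e rho l.+1 *m y0 = id_blockrow l.
Proof. by rewrite stack0E coord_eq. Qed.

Lemma Gsum_y0 (rho_gt0 : (0 < rho)%N) : Gsum y0 = G rho *m id_blockrow (Ordinal rho_gt0).
Proof.
rewrite /Gsum (@sum_ord_pred _ _ (fun j => G j.+1 *m (e j.+1 1 *m _)))// prednK//.
rewrite (y0_eq (Ordinal rho_gt0)) [X in X + _]big1 ?add0r// => j _.
by rewrite y0_lt ?mulmx0// /label; have := ltn_ord j; lia.
Qed.

Lemma y0_first (rho_gt0 : (0 < rho)%N) (a : 'I_(k.+1 - rho.+1)) :
  e (rho.+1 + a) 1 *m y0 = submxcol (G rho) a *m id_blockrow (Ordinal rho_gt0).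
Proof. by rewrite {1}stack0E coord_first add0r -stack0E Gsum_y0 submxcol_mul. Qed.

Lemma y0_rest i l : label k i l -> (rho < i)%N -> (1 < l)%N -> e i l *m y0 = 0.
Proof.
case: l => [|[|l]]// il ri _; case/and3P: (il) => _ li ik.
have [a ia] : exists a : 'I_(k - rho), i = (rho.+1 + a)%N.
  have ak : (i - rho.+1 < k - rho)%N by lia.
  by exists (Ordinal ak); rewrite subnKC.
subst i; have lc : (l < rho + a)%N by lia.
by rewrite stack0E (coord_rest _ _ _ _ (Ordinal lc)) !submxcol0.
Qed.

End ShearedCoordinates.

(** * Scaling and the limit pencil *)

(** Moves the factor [c = z ^+ rho] onto [L], where it cancels the negative powers. *)
Lemma mulmx_pert (K : comPzRingType) m n (A : 'M[K]_(m, n)) (c : K) (L N M R : 'M[K]_n) :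
  A *m L *m (N + c *: M) *m R = A *m (L *m N *m R + (c *: L) *m M *m R).
Proof.
by rewrite !mulmxDr !mulmxDl !mulmxA; do 4 rewrite -?scalemxAr -?scalemxAl.
Qed.

Section Scaling.
Context {C : numClosedFieldType} (s : nat -> nat) (k rho : nat).
Hypothesis rho_range : (1 <= rho <= k)%N.
Local Notation e := (@unit_blockrow C s k).

(* The blocks of [z L R], [z^rho L] and [R] are powers of [z] with these
   exponents, which makes sense of their limits as [z -> 0] since [0 ^+ 0 = 1]. *)
Definition uexp (i l : nat) : nat := if (i <= rho)%N then 0%N else (l <= i - rho)%N.
Definition pexp (i l : nat) : nat :=
  if (i <= rho)%N then (rho - l)%N
  else if (l <= i - rho)%N then rho else (rho - (l - (i - rho)))%N.
Definition rexp (i l : nat) : nat :=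
  if (i <= rho)%N then l.-1
  else if (l <= i - rho)%N then 0%N else (l - (i - rho)).-1.

Definition zdiag (f : nat -> nat -> nat) (z : C) : 'M[C]_(adim s k) :=
  scalediag s k (fun i l => z ^+ f i l).

Lemma unit_blockrow_zdiag f z i l : label k i l ->
  e i l *m zdiag f z = z ^+ f i l *: e i l.
Proof. exact: unit_blockrow_scalediag. Qed.

Lemma unit_blockrow_zdiag_mul p f z i l (y : 'M[C]_(adim s k, p)) : label k i l ->
  e i l *m (zdiag f z *m y) = z ^+ f i l *: (e i l *m y).
Proof. by move=> il; rewrite mulmxA (unit_blockrow_zdiag _ _ il) scalemxAl. Qed.

Lemma RmxE z : Rmx s k rho z = zdiag rexp z.
Proof.
apply: (@unit_blockrowP C s k) => i l il; rewrite [RHS](unit_blockrow_zdiag _ _ il).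
rewrite (unit_blockrow_scalediag _ (Rentry rho z) il) /Rentry /rexp.
by case: ifP => _ //; case: ifP.
Qed.

Lemma zLR z : z != 0 -> z *: (Lmx s k rho z *m Rmx s k rho z) = zdiag uexp z.
Proof.
move=> z0; apply: (@unit_blockrowP C s k) => i l il; rewrite [RHS](unit_blockrow_zdiag _ _ il).
rewrite -scalemxAr mulmxA (unit_blockrow_scalediag _ (Lentry rho z) il).
rewrite -scalemxAl (unit_blockrow_scalediag _ (Rentry rho z) il) !scalerA.
congr (_ *: _); case/and3P: il => l0 li ik; rewrite /Lentry /Rentry /uexp.
case: ifP => ir; first by rewrite mulrAC -exprS prednK// mulfV// expf_neq0.
case: ifP => lr; first by rewrite !mulr1.
by rewrite mulrAC -exprS prednK ?mulfV ?expf_neq0// subn_gt0 ltnNge lr.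
Qed.

Lemma zL z : z != 0 -> z ^+ rho *: Lmx s k rho z = zdiag pexp z.
Proof.
move=> z0; apply: (@unit_blockrowP C s k) => i l il; rewrite [RHS](unit_blockrow_zdiag _ _ il).
rewrite -scalemxAr (unit_blockrow_scalediag _ (Lentry rho z) il) !scalerA.
congr (_ *: _); case/and3P: il => l0 li ik; rewrite /Lentry /pexp.
case: ifP => ir; first by rewrite -expfB_cond// (negbTE z0) add0n; lia.
case: ifP => lr; first by rewrite mulr1.
by rewrite -expfB_cond// (negbTE z0) add0n; lia.
Qed.

Lemma LNR z : z != 0 -> Lmx s k rho z *m Nmx s k *m Rmx s k rho z = Nmx s k :> 'M[C]_(adim s k).
Proof.
move=> z0; apply: (@unit_blockrowP C s k) => i l il; rewrite !mulmxA.
rewrite (unit_blockrow_scalediag _ (Lentry rho z) il) -!scalemxAl.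
rewrite (unit_blockrow_Nmx _ il); case: ltnP => li; last by rewrite mul0mx scaler0.
have il' : label k i l.+1 by case/and3P: il => l0 _ ik; apply/and3P.
rewrite (unit_blockrow_scalediag _ (Rentry rho z) il') scalerA.
rewrite (_ : _ * _ = 1) ?scale1r//; rewrite /Lentry /Rentry.
case: ifP => ir; first by rewrite mulVf// expf_neq0.
(* The scalar is the entry of [L] at [l] times that of [R] at [l + 1]. At the break [l = i - rho]
   the first is 1 and the second is [z ^+ 0]. *)
case: ifP => lr; case: ifP => lr'; rewrite ?mulr1//.
- by rewrite (_ : _.-1 = 0)%N ?expr0 ?mulr1//; lia.
- by lia.
- by rewrite (_ : _.-1 = l - (i - rho))%N ?mulVf ?expf_neq0//; lia.
Qed.

Context (n q : nat) (D : 'M[C]_n) (Xi Sg : forall i l : nat, 'M[C]_(n, s i)).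
Context (Xic : 'M[C]_(n, q)).
Local Notation PiL := (@PiL C s k rho).
Local Notation PiR := (@PiR C s k rho).
Local Notation Gmx := (Gmx k D Xi Sg rho).

Definition Upoly (z : C) : 'M[C]_(dimUV s k rho) :=
  PiL *m zdiag uexp z *m PiR *m Gmx.

Definition Npert (z : C) (M : 'M[C]_(adim s k)) : 'M[C]_(adim s k) :=
  Nmx s k + zdiag pexp z *m M *m zdiag rexp z.

Definition Vpoly (z : C) (M : 'M[C]_(adim s k)) : 'M[C]_(dimUV s k rho) :=
  PiL *m Npert z M *m PiR *m Gmx.

Lemma UhatE z : z != 0 -> Uhat k D Xi Sg rho z = Upoly z.
Proof. by move=> z0; rewrite /Uhat zLR. Qed.

Lemma VhatE z P : z != 0 ->
  Vhat D Xi Sg Xic rho z P = Vpoly z (D11 k D Xi Sg + D12 k D Sg Xic *m P).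
Proof.
move=> z0; by rewrite /Vhat /Vpoly /Npert mulmx_pert (LNR z0) (zL z0) RmxE.
Qed.

End Scaling.

Lemma sum_shat (V : nmodType) (F : nat -> V) (k rho : nat) : (1 <= rho <= k)%N ->
  \sum_(i < k) (if (rho <= i.+1)%N then F i.+1 else 0) =
  \sum_(a < k.+1 - rho) F (rho + a)%N.
Proof.
case: rho => // r /= rk; rewrite subSS.
rewrite -(big_mkord xpredT (fun i => if (r < i.+1)%N then F i.+1 else 0)).
rewrite (big_cat_nat (n := r)) ?(ltnW rk)//= big_nat big1 ?add0r; last first.
  by move=> i; rewrite ltnS; case: leqP.
rewrite -{1}[r]add0n big_addn big_mkord; apply: eq_bigr => i _.
by rewrite ltnS leq_addl addSn addnC.
Qed.

Lemma sum_shatS (V : nmodType) (F : nat -> V) (k rho : nat) : (rho <= k)%N ->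
  \sum_(a < k.+1 - rho) F (rho + a)%N =
  F rho + \sum_(a < k.+1 - rho.+1) F (rho.+1 + a)%N.
Proof.
move=> rk; rewrite subSn// big_ord_recl addn0 subSS; congr (_ + _).
by apply: eq_bigr => i _; rewrite addSnnS lift0.
Qed.

(** * Use of the invertibility of the W_i *)

Section WKernel.
Context {C : numClosedFieldType} (s : nat -> nat) (k n : nat).
Context (D : 'M[C]_n) (Xi Sg : forall i l : nat, 'M[C]_(n, s i)).
Local Notation e := (@unit_blockrow C s k).
Hypothesis W_unit : forall i : nat, (1 <= i <= k)%N -> W k D Xi Sg i \in unitmx.

(** The hypothesis says that [W i] kills the stacked blocks [(i + a, 1)]. It is applied with
    [i = rho] to invert [Theta] and with [i = rho + 1] for the linearization; for [i = k + 1] no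
    index [a] exists. *)
Lemma W_kernel p (y : 'M[C]_(adim s k, p)) i : (1 <= i)%N ->
    (forall b : 'I_(k.+1 - i), (Sg (i + b) (i + b))^t* *m D *m
       \sum_(a < k.+1 - i) Xi (i + a) 1 *m (e (i + a) 1 *m y) = 0) ->
  forall a : 'I_(k.+1 - i), e (i + a) 1 *m y = 0.
Proof.
move=> i1 H a; have ik : (1 <= i <= k)%N by have := ltn_ord a; lia.
pose w : 'M[C]_(shat s k i, p) := \mxcol_(a < k.+1 - i) (e (i + a) 1 *m y).
suff w0 : w = 0 by rewrite -[LHS](mxcolK (fun a : 'I_(k.+1 - i) => e (i + a) 1 *m y)) -/w w0 submxcol0.
suff Ww : W k D Xi Sg i *m w = 0 by rewrite -(mulKmx (W_unit ik) w) Ww mulmx0.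
rewrite /W -!mulmxA /Xitilde mul_mxrow_mxcol mulmxA; apply/mxcolP => b.
rewrite submxcol0 -!submxcol_mul -(H b); congr (_ *m _ *m _).
rewrite -[Sg _ _](mxrowK (fun b : 'I_(k.+1 - i) => Sg (i + b)%N (i + b)%N)).
by apply/matrixP => ? ?; rewrite !mxE.
Qed.

End WKernel.

Section Limit.
Context {C : numClosedFieldType} (s : nat -> nat) (k rho n : nat).
Hypothesis rho_range : (1 <= rho <= k)%N.
Context (D : 'M[C]_n) (Xi Sg : forall i l : nat, 'M[C]_(n, s i)).
Local Notation e := (@unit_blockrow C s k).
Local Notation PiL := (@PiL C s k rho).
Local Notation PiR := (@PiR C s k rho).
Local Notation G := (Gj k D Xi Sg rho).
Local Notation Gmx := (Gmx k D Xi Sg rho).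
Local Notation M0 := (D11 k D Xi Sg).
Hypothesis W_unit : forall i : nat, (1 <= i <= k)%N -> W k D Xi Sg i \in unitmx.

Lemma unit_blockrow_D11 p (v : 'M[C]_(adim s k, p)) i l : label k i l ->
  e i l *m (M0 *m v) = (Sg i l)^t* *m D *m (assemble k Xi *m v).
Proof. by move=> il; rewrite /D11 -!mulmxA mulmxA unit_blockrow_assemble. Qed.

Lemma unit_blockrow_Npert p z M (y : 'M[C]_(adim s k, p)) i l : label k i l ->
  e i l *m (Npert rho z M *m y) = (if (l < i)%N then e i l.+1 *m y else 0)
    + z ^+ pexp rho i l *: (e i l *m (M *m (zdiag s k (rexp rho) z *m y))).
Proof.
move=> il; rewrite mulmxDl mulmxDr mulmxA (unit_blockrow_Nmx _ il).
congr (_ + _); first by case: ifP; rewrite ?mul0mx.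
by rewrite !mulmxA (unit_blockrow_zdiag _ _ _ il) -!scalemxAl.
Qed.

Definition lead : 'M[C]_(n, s rho) := Xi rho 1 + Xitilde k Xi rho.+1 *m G rho.

(** [G rho] solves [W_{rho+1} G = - Sigmatilde_{rho+1}^t* D Xi_{rho 1}]. For [rho = k] there is no
    [b], so only [W] with index at most [k] is inverted. *)
Lemma Sigma_lead (b : 'I_(k.+1 - rho.+1)) :
  (Sg (rho.+1 + b) (rho.+1 + b))^t* *m D *m lead = 0.
Proof.
have rk : (1 <= rho.+1 <= k)%N by have := ltn_ord b; lia.
have : (Sigmatilde k Sg rho.+1)^t* *m D *m lead = 0.
  rewrite /lead mulmxDr mulmxA -/(W k D Xi Sg rho.+1) /Gj mulmxN !mulmxA.
  by rewrite mulmxV ?W_unit// mul1mx subrr.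
move=> /(congr1 (fun A => submxcol A b)); rewrite submxcol0 -!submxcol_mul => <-.
congr (_ *m _ *m _).
rewrite -[Sg _ _](mxrowK (fun b : 'I_(k.+1 - rho.+1) => Sg (rho.+1 + b)%N (rho.+1 + b)%N)).
by apply/matrixP => ? ?; rewrite !mxE.
Qed.

Lemma Sigma_lead_rho : (Sg rho rho)^t* *m D *m lead = Smx k D Xi Sg rho.
Proof. by rewrite /lead /Smx mulmxDr !mulmxA. Qed.

(** At [z = 0] the scaling [R] keeps only exponent 0. On the chain [i = rho] this removes all labels
    [l > 1]; the hypotheses on [y] remove the rest except the [(i, 1)] with [i >= rho]. *)
Lemma assemble_lead p (y : 'M[C]_(adim s k, p)) :
    (forall i l, label k i l -> (i < rho)%N -> e i l *m y = 0) ->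
    (forall i l, label k i l -> (rho < i)%N -> (1 < l)%N -> e i l *m y = 0) ->
  assemble k Xi *m (zdiag s k (rexp rho) 0 *m y) =
  \sum_(a < k.+1 - rho) Xi (rho + a) 1 *m (e (rho + a) 1 *m y).
Proof.
move=> y_lt y_gt; rewrite assemble_mul -(sum_shat (fun i => Xi i 1 *m (e i 1 *m y)))//.
apply: eq_bigr => i _; have lab (l : 'I_i.+1) : label k i.+1 l.+1.
  by rewrite /label; have := ltn_ord l; have := ltn_ord i; lia.
case: leqP => ir; last first.
  by apply: big1 => l _; rewrite (unit_blockrow_zdiag_mul _ _ _ (lab l)) y_lt ?scaler0 ?mulmx0.
rewrite big_ord_recl [X in _ + X]big1 ?addr0 => [|l _].
  rewrite (unit_blockrow_zdiag_mul _ _ _ (lab ord0)).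
  rewrite (_ : rexp _ _ _ = 0)%N ?expr0 ?scale1r// /rexp/=.
  by case: ifP => // ir'; case: ifP => //=; lia.
rewrite (unit_blockrow_zdiag_mul _ _ _ (lab (lift ord0 l))).
move: ir; rewrite leq_eqVlt => /predU1P[ir|ir]; last by rewrite y_gt ?scaler0 ?mulmx0.
have -> : rexp rho i.+1 (lift ord0 l).+1 = l.+1 by rewrite /rexp ir leqnn lift0.
by rewrite expr0n scale0r mulmx0.
Qed.

End Limit.

(** * The pencil at z = 0: solution, invertibility of Theta, injectivity *)

Section Pencil.
Context {C : numClosedFieldType} (s : nat -> nat) (k rho n : nat).
Hypothesis rho_range : (1 <= rho <= k)%N.
Context (D : 'M[C]_n) (Xi Sg : forall i l : nat, 'M[C]_(n, s i)).
Hypothesis W_unit : forall i : nat, (1 <= i <= k)%N -> W k D Xi Sg i \in unitmx.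
Local Notation e := (@unit_blockrow C s k).
Local Notation PiL := (@PiL C s k rho).
Local Notation PiR := (@PiR C s k rho).
Local Notation G := (Gj k D Xi Sg rho).
Local Notation Gmx := (Gmx k D Xi Sg rho).
Local Notation M0 := (D11 k D Xi Sg).
Local Notation stack0 := (@stack0 C s k rho).
Local Notation y0 := (PiR *m (Gmx *m stack0)).
Local Notation Theta := (Theta k D Xi Sg rho).
Local Notation Smx := (Smx k D Xi Sg rho).
Local Notation lead := (lead k rho D Xi Sg).
Local Notation middle := (@middle C s k rho).
Local Notation Upoly := (Upoly k rho D Xi Sg).
Local Notation Vpoly := (Vpoly rho D Xi Sg).
Local Notation id_blockrow := (@id_blockrow C s rho).

Let rho_gt0 : (0 < rho)%N. Proof. by case/andP: rho_range. Qed.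
Definition ord_rho0 : 'I_rho := Ordinal rho_gt0.
Local Notation id_blockrow0 := (id_blockrow ord_rho0).

Lemma id_blockrow_mxrow (l : 'I_rho) :
  id_blockrow l = \mxrow_(b < rho) (if b == l :> nat then 1%:M else 0).
Proof.
rewrite -[RHS]mulmx1 -[X in _ *m X]submxcolK mul_mxrow_mxcol [RHS](bigD1 l)//= eqxx mul1mx.
rewrite [X in _ + X]big1 ?addr0// => b; rewrite -val_eqE/= => /negPf ->.
by rewrite mul0mx.
Qed.

Lemma id_blockrow_mul p (l : 'I_rho) (M : 'M[C]_(dim2 s rho, p)) : id_blockrow l *m M = submxcol M l.
Proof. by rewrite /id_blockrow submxcol_mul mul1mx. Qed.

Lemma Theta_next (l l' : 'I_rho) : l' = l.+1 :> nat -> submxcol Theta l = id_blockrow l'.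
Proof.
move=> ll; rewrite /Theta mxblockEv mxcolK id_blockrow_mxrow; apply: eq_mxrow => b.
by rewrite ll; case: ifP => // _; rewrite (_ : (l.+1 == rho) = false)//; have := ltn_ord l'; lia.
Qed.

Lemma Theta_last (l : 'I_rho) : l.+1 = rho -> submxcol Theta l = Smx *m id_blockrow0.
Proof.
move=> lr; rewrite /Theta mxblockEv mxcolK id_blockrow_mxrow mul_mxrow; apply: eq_mxrow => b.
rewrite (_ : (b == l.+1 :> nat) = false) ?lr ?eqxx/=; last by have := ltn_ord b; lia.
by case: ifP; rewrite ?mulmx1 ?mulmx0.
Qed.

Lemma UpolyS z p (S : 'M[C]_(dimUV s k rho, p)) :
  Upoly z *m S = PiL *m (zdiag s k (uexp rho) z *m (PiR *m (Gmx *m S))).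
Proof. by rewrite /Upoly -!mulmxA. Qed.

Lemma VpolyS z M p (S : 'M[C]_(dimUV s k rho, p)) :
  Vpoly z M *m S = PiL *m (Npert rho z M *m (PiR *m (Gmx *m S))).
Proof. by rewrite /Vpoly -!mulmxA. Qed.

Lemma middle_Upoly z : middle *m Upoly z = middle.
Proof.
rewrite -[LHS]mulmx1 -mulmxA UpolyS middle_PiL -[RHS]mulmx1 (middle_coord rho_range D Xi Sg).
apply: eq_mxcol => l; rewrite unit_blockrow_zdiag_mul; last by rewrite /label; have := ltn_ord l; lia.
by rewrite /uexp leqnn scale1r.
Qed.

Lemma assemble_y0 : assemble k Xi *m (zdiag s k (rexp rho) 0 *m y0) = lead *m id_blockrow0.
Proof.
rewrite (assemble_lead rho_range); last 2 first.
- by move=> i l; exact: y0_lt.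
- by move=> i l; exact: y0_rest.
have rk : (rho <= k)%N by case/andP: rho_range.
rewrite (@sum_shatS _ (fun i => Xi i 1 *m (e i 1 *m y0)))// (y0_eq rho_range D Xi Sg ord_rho0).
rewrite /lead mulmxDl -mulmxA -[G rho]submxcolK mxcol_mul /Xitilde mul_mxrow_mxcol.
by congr (_ + _); apply: eq_bigr => a _; rewrite (y0_first rho_range D Xi Sg rho_gt0).
Qed.

Lemma Npert0_y0_next (l l' : 'I_rho) : l' = l.+1 :> nat ->
  e rho l.+1 *m (Npert rho 0 M0 *m y0) = id_blockrow l'.
Proof.
move=> ll; have lab : label k rho l.+1 by rewrite /label; have := ltn_ord l; lia.
rewrite unit_blockrow_Npert// ifT; last by rewrite -ll.
have -> : l.+2 = l'.+1 by rewrite ll.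
rewrite (y0_eq rho_range D Xi Sg) (_ : pexp _ _ _ = (rho - l.+2).+1).
  by rewrite expr0n scale0r addr0.
by rewrite /pexp leqnn; have := ltn_ord l'; lia.
Qed.

Lemma Npert0_y0_last : e rho rho *m (Npert rho 0 M0 *m y0) = Smx *m id_blockrow0.
Proof.
have lab : label k rho rho by rewrite /label; lia.
rewrite unit_blockrow_Npert// ltnn add0r (_ : pexp _ _ _ = 0)%N.
  by rewrite expr0 scale1r unit_blockrow_D11// assemble_y0 mulmxA Sigma_lead_rho.
by rewrite /pexp leqnn subnn.
Qed.

(** Together with [pexp_diag]: in the limit the perturbation [M0] survives exactly in the rows
    [(i, i)] with [i >= rho]; all other rows see only the shift [N]. *)
Lemma pexp_gt0 i l : label k i l -> ~~ ((rho <= i)%N && (l == i)) ->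
  (0 < pexp rho i l)%N.
Proof.
case/and3P => l0 li ik; rewrite /pexp; case: ifP => ir; first by lia.
by case: ifP => lr; lia.
Qed.

Lemma pexp_diag i : label k i i -> (rho <= i)%N -> pexp rho i i = 0%N.
Proof.
case/and3P => l0 li ik ir; rewrite /pexp; case: ifP => ir'; first by lia.
by case: ifP => lr; lia.
Qed.

(** The shift reads a label [l + 1 > 1], where [y0] vanishes off the chain [rho]; the perturbation
    remains only in rows [(i, i)], [i > rho], where [Sigma_lead] kills it. *)
Lemma Npert0_y0_eq0 i l : label k i l -> i != rho ->
  e i l *m (Npert rho 0 M0 *m y0) = 0.
Proof.
move=> il ir; rewrite unit_blockrow_Npert//.
rewrite [X in X + _](_ : _ = 0); last first.
  case: ltnP => // li; have il' : label k i l.+1 by rewrite /label; case/and3P: il; lia.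
  move: ir; rewrite neq_ltn => /orP[ir|ir]; first exact: y0_lt.
  by apply: y0_rest => //; case/and3P: il.
rewrite add0r; case: (boolP ((rho <= i)%N && (l == i))) => [/andP[ir' /eqP li]|h]; last first.
  by have := pexp_gt0 il h; case: pexp => // m _; rewrite expr0n scale0r.
subst l; rewrite pexp_diag// expr0 scale1r unit_blockrow_D11// assemble_y0 mulmxA.
have [b ib] : exists b : 'I_(k.+1 - rho.+1), i = (rho.+1 + b)%N.
  have bk : (i - rho.+1 < k.+1 - rho.+1)%N by case/and3P: il; lia.
  by exists (Ordinal bk); rewrite subnKC; lia.
by subst i; rewrite Sigma_lead ?mul0mx.
Qed.

Lemma middle_Vpoly0 : middle *m (Vpoly 0 M0 *m stack0) = Theta.
Proof.
rewrite VpolyS middle_PiL -[RHS]submxcolK; apply: eq_mxcol => l.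
case: (ltnP l.+1 rho) => lr.
  by rewrite (@Theta_next l (Ordinal lr))// (@Npert0_y0_next l (Ordinal lr)).
have lr' : l.+1 = rho by have := ltn_ord l; lia.
by rewrite Theta_last// lr' Npert0_y0_last.
Qed.

Lemma unit_row_Theta (l : 'I_rho) : id_blockrow l *m Theta = e rho l.+1 *m (Npert rho 0 M0 *m y0).
Proof. by rewrite -middle_Vpoly0 VpolyS middle_PiL id_blockrow_mul mxcolK. Qed.

Lemma zdiag_uexp_y0 i l : label k i l -> i != rho ->
  e i l *m (zdiag s k (uexp rho) 0 *m y0) = 0.
Proof.
move=> il ir; rewrite unit_blockrow_zdiag_mul//.
move: ir; rewrite neq_ltn => /orP[ir|ir]; first by rewrite y0_lt// scaler0.
have [l1|l1] := ltnP 1 l; first by rewrite y0_rest// scaler0.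
have -> : uexp rho i l = 1%N by rewrite /uexp leqNgt ir/=; case/and3P: il; lia.
by rewrite expr1 scale0r.
Qed.

Lemma pencil_limit : Upoly 0 *m stack0 *m Theta = Vpoly 0 M0 *m stack0.
Proof.
rewrite UpolyS VpolyS -mulmxA; congr (PiL *m _).
apply: (@unit_blockrowP C s k) => i l il; rewrite mulmxA.
have [ir|ir] := eqVneq i rho; last by rewrite zdiag_uexp_y0// Npert0_y0_eq0// mul0mx.
subst i; rewrite unit_blockrow_zdiag_mul// /uexp leqnn scale1r.
have lr : (l.-1 < rho)%N by case/and3P: il; lia.
have -> : l = (Ordinal lr).+1 by rewrite /=; case/and3P: il; lia.
by rewrite y0_eq// unit_row_Theta.
Qed.

(** The superdiagonal identities force all blocks of a kernel vector but the first, [w0], to vanish,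
    and the last row gives [Smx w0 = 0]. Then [[w0; G w0]] lies in the kernel of [W_rho]: this is
    the Schur complement argument in kernel form. *)
Lemma Theta_unit : Theta \in unitmx.
Proof.
suff inj : forall p (w : 'M[C]_(dim2 s rho, p)), Theta *m w = 0 -> w = 0.
  rewrite -row_full_unit -cokermx_eq0; apply/eqP/inj; exact: mulmx_coker.
move=> p w Tw.
have Ew (l : 'I_rho) : l != ord_rho0 -> id_blockrow l *m w = 0.
  rewrite -val_eqE/= => l0; have lr : (l.-1 < rho)%N by have := ltn_ord l; lia.
  rewrite -(@Theta_next (Ordinal lr) l)/=; last by lia.
  by rewrite submxcol_mul Tw submxcol0.
have SE : Smx *m (id_blockrow0 *m w) = 0.
  have lr : (rho.-1 < rho)%N by lia.
  rewrite mulmxA -(@Theta_last (Ordinal lr))/=; last by lia.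
  by rewrite submxcol_mul Tw submxcol0.
have y0w : forall a : 'I_(k.+1 - rho), e (rho + a) 1 *m (y0 *m w) = 0.
  apply: (W_kernel W_unit) => // b.
  rewrite -(assemble_lead rho_range); last 2 first.
  - by move=> i l il ir; rewrite mulmxA (y0_lt rho_range D Xi Sg il ir) mul0mx.
  - by move=> i l il ir l1; rewrite mulmxA (y0_rest rho_range D Xi Sg il ir l1) mul0mx.
  rewrite (mulmxA (zdiag _ _ _ _)) (mulmxA (assemble _ _)) assemble_y0 -!(mulmxA lead).
  (* The row [b = 0] of [W_rho] gives [Smx], the others vanish by the choice of [G]. *)
  have [b0|b0] := eqVneq (b : nat) 0%N.
    by rewrite b0 addn0 mulmxA Sigma_lead_rho.
  have bk : (b.-1 < k.+1 - rho.+1)%N by have := ltn_ord b; lia.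
  have -> : (rho + b = rho.+1 + Ordinal bk)%N by rewrite /=; lia.
  by rewrite mulmxA Sigma_lead// mul0mx.
have E0w : id_blockrow0 *m w = 0.
  have kr : (0 < k.+1 - rho)%N by lia.
  have := y0w (Ordinal kr); rewrite /= addn0 mulmxA.
  by rewrite (y0_eq rho_range D Xi Sg ord_rho0).
apply/mxcolP => l; rewrite submxcol0 -id_blockrow_mul.
by have [->|/Ew] := eqVneq l ord_rho0.
Qed.

(** The left side minus the right side is the derivative of [U S (middle V S) - V S] at
    [S = stack0], with [U], [V] at [z = 0], restricted to directions with zero middle block. *)
Lemma pencil_injective (X : 'M[C]_(dimUV s k rho, dim2 s rho)) :
    middle *m X = 0 ->
    Upoly 0 *m X *m Theta + Upoly 0 *m stack0 *m (middle *m (Vpoly 0 M0 *m X))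
      = Vpoly 0 M0 *m X ->
  X = 0.
Proof.
set Y := middle *m (Vpoly 0 M0 *m X) => X0 eqX.
apply: (PiR_Gmx_eq0 rho_range (D := D) (Xi := Xi) (Sg := Sg)).
set y := PiR *m (Gmx *m X).
(* Off the chain [rho] the limit of [z L R] kills [y0], so the unknown [Y] drops out of these
   rows. *)
have eqy i l : label k i l -> i != rho ->
    0 ^+ uexp rho i l *: (e i l *m y *m Theta) = e i l *m (Npert rho 0 M0 *m y).
  move=> il ir; move: eqX; rewrite !UpolyS VpolyS -!(mulmxA PiL) -mulmxDr.
  move=> /(PiL_inj rho_range)/(congr1 (mulmx (e i l))); rewrite mulmxDr.
  rewrite (mulmxA (e i l) _ Theta) (mulmxA (e i l) _ Y) zdiag_uexp_y0// mul0mx addr0.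
  by rewrite unit_blockrow_zdiag_mul// -scalemxAl.
have y_eq l : label k rho l -> e rho l *m y = 0.
  move=> il; have lr : (l.-1 < rho)%N by case/and3P: il; lia.
  have -> : l = (Ordinal lr).+1 by rewrite /=; case/and3P: il; lia.
  move: X0; rewrite (middle_coord rho_range D Xi Sg) -/y.
  by move/(congr1 (fun A => submxcol A (Ordinal lr))); rewrite mxcolK submxcol0.
(* Here the row reads [y_{il} Theta = y_{i,l+1}], with zero right side at [l = i]; [Theta] is
   cancelled while descending in [l]. *)
have y_lt i l : label k i l -> (i < rho)%N -> e i l *m y = 0.
  move=> il ir; have [m lm] : exists m, (i - l <= m)%N by exists (i - l)%N.
  elim: m l lm il => [|m IH] l lm il; have := eqy i l il;
    rewrite neq_ltn ir unit_blockrow_Npert// /uexp (ltnW ir) scale1r => /(_ isT).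
  - rewrite ltnNge (_ : (i <= l)%N) /=; last by lia.
    have : (0 < pexp rho i l)%N by apply: pexp_gt0 => //; lia.
    case: pexp => // d _; rewrite expr0n scale0r addr0 => yT.
    by rewrite -(mulmxK Theta_unit (e i l *m y)) yT mul0mx.
  - have : (0 < pexp rho i l)%N by apply: pexp_gt0 => //; lia.
    case: pexp => // d _; rewrite expr0n scale0r addr0 => yT.
    rewrite -(mulmxK Theta_unit (e i l *m y)) yT.
    case: ltnP => li; rewrite ?mul0mx// IH ?mul0mx//; first by lia.
    by rewrite /label; case/and3P: il; lia.
(* Here the row expresses [y_{i,l+1}] through [y_{il}]. The start [l = 1] works without knowing
   [y_{i1}], because its factor is [0 ^+ 1]. *)
have y_gt i l : label k i l -> (rho < i)%N -> (1 < l)%N -> e i l *m y = 0.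
  case: l => // l + ir; elim: l => // l IH il _.
  have il' : label k i l.+1 by rewrite /label; case/and3P: il; lia.
  have := eqy i l.+1 il'; rewrite neq_ltn ir orbT unit_blockrow_Npert// => /(_ isT).
  rewrite ifT; last by case/and3P: il.
  have : (0 < pexp rho i l.+1)%N by apply: pexp_gt0 => //; case/and3P: il; lia.
  case: pexp => // d _; rewrite [0 ^+ d.+1]expr0n scale0r addr0 => <-.
  case: l IH il il' => [|l] IH il il'; last by rewrite IH// mul0mx scaler0.
  by rewrite (_ : uexp rho i 1 = 1%N) ?scale0r// /uexp leqNgt ir/=; lia.
(* Only the blocks [(i, 1)] are left, and the rows [(i, i)] say that [W_{rho+1}] annihilates
   them. *)
have y_first : forall a : 'I_(k.+1 - rho.+1), e (rho.+1 + a) 1 *m y = 0.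
  apply: (W_kernel W_unit) => // b; set i := (rho.+1 + b)%N.
  have il : label k i i by rewrite /label /i; have := ltn_ord b; lia.
  have ir : (rho < i)%N by rewrite /i; lia.
  have := eqy i i il; rewrite neq_ltn ir orbT unit_blockrow_Npert// => /(_ isT).
  rewrite ltnn add0r pexp_diag ?(ltnW ir)// expr0 scale1r unit_blockrow_D11//.
  rewrite (assemble_lead rho_range _ y_lt y_gt) y_gt//; last by lia.
  rewrite mul0mx scaler0 (@sum_shatS _ (fun i => Xi i 1 *m (e i 1 *m y))); last by lia.
  by rewrite y_eq ?mulmx0 ?add0r// /label; lia.
apply: (@unit_blockrowP C s k) => i l il; rewrite mulmx0.
have [ir|ir|ir] := ltngtP i rho; first exact: y_lt; last by subst i; exact: y_eq.
have [l1|l1] := ltnP 1 l; first exact: y_gt.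
have bk : (i - rho.+1 < k.+1 - rho.+1)%N by case/and3P: il; lia.
have -> : l = 1%N by case/and3P: il; lia.
by have := y_first (Ordinal bk); rewrite /= subnKC.
Qed.

End Pencil.

(** * Existence of X1, X2 and P *)

(* Expands both sides into sums of products, which become atoms, so that the
   commutative [ring] applies to the entries. *)
Ltac mx_ring :=
  rewrite ?(mulmxBl, mulmxBr, mulmxDl, mulmxDr, mulNmx, mulmxN) ?mulmxA;
  repeat move: (_ *m _) => ?;
  apply/matrixP => ? ?; rewrite !mxE; ring.

Section PencilIdentities.
Context {A : comPzRingType} {m p : nat} (U U0 V V0 : 'M[A]_m) (K : 'M[A]_(p, m)).
Implicit Types S X Y : 'M[A]_(m, p).

Lemma pencil_sub0 S :
  U0 *m S *m (K *m (V0 *m S)) = V0 *m S ->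
  (U - U0) *m S *m (K *m (V *m S)) + U0 *m S *m (K *m ((V - V0) *m S))
    - (V - V0) *m S
  = U *m (S + 0) *m (K *m (V *m (S + 0))) - V *m (S + 0).
Proof.
move=> lim; rewrite addr0 -[RHS]subr0.
have <- : U0 *m S *m (K *m (V0 *m S)) - V0 *m S = 0 by rewrite lim subrr.
mx_ring.
Qed.

(** Besides [X - Y], each term on the right has a factor [U - U0], [V - V0], [X] or [Y], hence is
    small. *)
Lemma pencil_subB S X Y :
  (U *m (S + X) *m (K *m (V *m (S + X))) - V *m (S + X))
  - (U *m (S + Y) *m (K *m (V *m (S + Y))) - V *m (S + Y))
  - (U0 *m (X - Y) *m (K *m (V0 *m S)) + U0 *m S *m (K *m (V0 *m (X - Y)))
     - V0 *m (X - Y))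
  = (U - U0) *m (X - Y) *m (K *m (V *m (S + X)))
  + U0 *m (X - Y) *m (K *m ((V - V0) *m (S + X)))
  + U0 *m (X - Y) *m (K *m (V0 *m X))
  + (U - U0) *m (S + Y) *m (K *m (V *m (X - Y)))
  + U0 *m Y *m (K *m (V *m (X - Y)))
  + U0 *m S *m (K *m ((V - V0) *m (X - Y)))
  - (V - V0) *m (X - Y).
Proof. mx_ring. Qed.

Lemma pencil_middleB S X :
  K *m ((V - V0) *m S) + K *m (V *m (S + X - S)) =
  K *m (V *m (S + X)) - K *m (V0 *m S).
Proof. mx_ring. Qed.

End PencilIdentities.

Section Deflation.
Context {R : realType}.
Local Notation C := R[i].

(** As a relation, bounds compose along the structure of an expression, so that a long sum of
    products is estimated by one proof term. *)
Definition bnd m p (M : 'M[C]_(m, p)) (a : R) : Prop := nrm M <= a.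

Lemma bndM m n p (M : 'M[C]_(m, n)) (N : 'M[C]_(n, p)) a b :
  bnd M a -> bnd N b -> bnd (M *m N) (a * b).
Proof. by move=> Ma Nb; rewrite /bnd (le_trans (nrmM _ _))// ler_pM// nrm_ge0. Qed.

Lemma bndD m p (M N : 'M[C]_(m, p)) a b : bnd M a -> bnd N b -> bnd (M + N) (a + b).
Proof. by move=> Ma Nb; rewrite /bnd (le_trans (nrmD _ _))// lerD. Qed.

Lemma bndN m p (M : 'M[C]_(m, p)) a : bnd M a -> bnd (- M) a.
Proof. by rewrite /bnd nrmN. Qed.

Lemma bndZ m p (t : R) (M : 'M[C]_(m, p)) a b :
  0 <= t -> t <= b -> bnd M a -> bnd (t%:C *: M) (b * a).
Proof.
by move=> t0 tb Ma; rewrite /bnd nrmZ cabs_real// ler_pM// nrm_ge0.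
Qed.

Lemma bnd_self m p (M : 'M[C]_(m, p)) : bnd M (nrm M).
Proof. exact: lexx. Qed.

Section Pencil.
Context {m p : nat} (U V : R -> 'M[C]_m) (U0 V0 : 'M[C]_m).
Context (K : 'M[C]_(p, m)) (S0 : 'M[C]_(m, p)).
Hypothesis OU : isO (fun z => U z - U0) 1.
Hypothesis OV : isO (fun z => V z - V0) 1.
Hypothesis KU : forall z, K *m U z = K.
Hypothesis KU0 : K *m U0 = K.
Hypothesis KS0 : K *m S0 = 1%:M.
Hypothesis limit : U0 *m S0 *m (K *m (V0 *m S0)) = V0 *m S0.
Hypothesis Theta_unit : K *m (V0 *m S0) \in unitmx.
Hypothesis injective_limit : forall X : 'M[C]_(m, p), K *m X = 0 ->
  U0 *m X *m (K *m (V0 *m S0)) + U0 *m S0 *m (K *m (V0 *m X)) = V0 *m X -> X = 0.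

Let F z X := U z *m (S0 + X) *m (K *m (V z *m (S0 + X))) - V z *m (S0 + X).

Let T : {linear 'M[C]_(m, p) -> 'M[C]_(m, p)} :=
  (mulmxr (K *m (V0 *m S0)) \o mulmx U0) \+ (mulmx (U0 *m S0) \o (mulmx K \o mulmx V0))
   \- mulmx V0.

Let TE X : T X = U0 *m X *m (K *m (V0 *m S0)) + U0 *m S0 *m (K *m (V0 *m X)) - V0 *m X.
Proof. by []. Qed.

Let T_inj X : T X = 0 -> X = 0.
Proof.
rewrite TE => T0; apply: injective_limit; last by apply/eqP; rewrite -subr_eq0 T0.
(* Since [K U0 = K] and [K S0 = 1], the two terms with [K V0 X] cancel and [K X Theta = 0] remains,
   so the constraint [K X = 0] follows from the equation. *)
move/(congr1 (mulmx K)): T0; rewrite mulmxBr mulmxDr !mulmxA KU0 KS0 mul1mx addrK mulmx0.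
move=> KX; rewrite -(mulmxK Theta_unit (K *m X)).
by rewrite [_ *m (K *m _)](_ : _ = 0) ?mul0mx// -KX !mulmxA.
Qed.

Let F_small : exists c : R, \forall z \near 0^'+, nrm (F z 0) <= c * z.
Proof.
have OV1 : isO V 0.
  apply: isO_near (isOD (isO_leq (leq0n 1) OV) (isO_cst V0)).
  by apply: nearW => z; rewrite subrK.
have [c Hc] : isO (fun z => F z 0) 1.
  have O1 := isOM (isOMr S0 OU) (isOMl K (isOMr S0 OV1)).
  have O2 := isOMl (U0 *m S0) (isOMl K (isOMr S0 OV)).
  apply: isO_near (isOB (isOD O1 O2) (isOMr S0 OV)).
  by apply: nearW => z; exact: pencil_sub0.
by exists c; apply: filterS Hc => z; rewrite expr1.
Qed.

Let F_lip : exists c : R, \forall z \near 0^'+, forall X Y, nrm X <= 1 -> nrm Y <= 1 ->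
  nrm (F z X - F z Y - T (X - Y)) <= c * (z + nrm X + nrm Y) * nrm (X - Y).
Proof.
have [a a0 Ha] := isO_pos OU; have [b b0 Hb] := isO_pos OV.
pose k := nrm K; pose u := nrm U0; pose v := nrm V0; pose o := nrm S0.
(* The summands bound the terms of [pencil_subB] in order, with [r = z + nrm X + nrm Y] and
   [nrm (X - Y)] taken out. *)
exists (a * (k * ((v + b) * (o + 1))) + u * (k * (b * (o + 1))) + u * (k * v)
   + a * (o + 1) * (k * (v + b)) + u * (k * (v + b)) + u * o * (k * b) + b).
apply: filterS2 Ha Hb => z [/andP[z0 z1] Uz] [_ Vz] X Y X1 Y1.
pose w := nrm (X - Y); pose r := z + nrm X + nrm Y.
have [x0 y0] := (nrm_ge0 X, nrm_ge0 Y).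
have Xr : bnd X r by rewrite /bnd /r; lra.
have Yr : bnd Y r by rewrite /bnd /r; lra.
have Ur : bnd (U z - U0) (a * r).
  by rewrite /bnd (le_trans Uz)// expr1 ler_wpM2l// /r; lra.
have Vr : bnd (V z - V0) (b * r).
  by rewrite /bnd (le_trans Vz)// expr1 ler_wpM2l// /r; lra.
have Vb : bnd (V z) (v + b).
  have -> : V z = V0 + (V z - V0) by rewrite addrC subrK.
  apply: bndD; first exact: bnd_self.
  by rewrite /bnd (le_trans Vz)// expr1 ler_piMr// ltW.
have SX : bnd (S0 + X) (o + 1) by apply: bndD => //; exact: bnd_self.
have SY : bnd (S0 + Y) (o + 1) by apply: bndD => //; exact: bnd_self.
have Wb : bnd (X - Y) w by exact: bnd_self.
have Kb : bnd K k by exact: bnd_self.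
have U0b : bnd U0 u by exact: bnd_self.
have V0b : bnd V0 v by exact: bnd_self.
have S0b : bnd S0 o by exact: bnd_self.
have B := bndD (bndD (bndD (bndD (bndD (bndD
  (bndM (bndM Ur Wb) (bndM Kb (bndM Vb SX)))
  (bndM (bndM U0b Wb) (bndM Kb (bndM Vr SX))))
  (bndM (bndM U0b Wb) (bndM Kb (bndM V0b Xr))))
  (bndM (bndM Ur SY) (bndM Kb (bndM Vb Wb))))
  (bndM (bndM U0b Yr) (bndM Kb (bndM Vb Wb))))
  (bndM (bndM U0b S0b) (bndM Kb (bndM Vr Wb))))
  (bndN (bndM Vr Wb)).
rewrite TE pencil_subB; apply: (le_trans B).
rewrite -/w -/r; lra.
Qed.

Lemma pencil_solution : exists S : R -> 'M[C]_(m, p),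
  isO (fun z => S z - S0) 1 /\
  \forall z \near 0^'+, K *m S z = 1%:M /\
    U z *m S z *m (K *m (V z *m S z)) = V z *m S z.
Proof.
have [c1 H1] := F_small; have [c2 H2] := F_lip.
pose c := `|c1| + `|c2|.
have [||X [B HX]] := @perturbed_zero _ _ _ T F c T_inj.
- apply: filterS2 (near0_lt ltr01) H1 => z /andP[z0 _] H; rewrite (le_trans H)//.
  by rewrite ler_wpM2r ?(ltW z0)// /c ler_wpDr// ler_norm.
- apply: filterS2 (near0_lt ltr01) H2 => z /andP[z0 _] H X Y X1 Y1.
  rewrite (le_trans (H X Y X1 Y1))// ler_wpM2r ?nrm_ge0// ler_wpM2r//.
    by rewrite !addr_ge0 ?nrm_ge0// ltW.
  by rewrite /c ler_wpDl// ler_norm.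
have OS : isO (fun z => S0 + X z - S0) 1.
  exists B; apply: filterS HX => z [XB _].
  by rewrite expr1 addrC addKr.
exists (fun z => S0 + X z); split=> //.
have OX : isO (fun z => K *m (V z *m (S0 + X z)) - K *m (V0 *m S0)) 1.
  have OV1 : isO V 0.
    apply: isO_near (isOD (isO_leq (leq0n 1) OV) (isO_cst V0)).
    by apply: nearW => z; rewrite subrK.
  apply: isO_near (isOD (isOMl K (isOMr S0 OV)) (isOMl K (isOM OV1 OS))).
  by apply: nearW => z; exact: pencil_middleB.
have [k k0 Hk] := isO_unit Theta_unit OX.
apply: filterS2 HX Hk => z [_ FX] Hz.
have eqX := FX; move/eqP: FX; rewrite /F subr_eq0 => /eqP FX; split=> //.
(* Multiplying the equation by [K] gives [(1 + K X) Q = Q] with [Q] the perturbed [Theta_hat]; as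
   [Q] is near a unit, [K X = 0]. *)
have KX : K *m X z *m (K *m (V z *m (S0 + X z))) = 0.
  move/(congr1 (mulmx K)): FX; move: (K *m (V z *m (S0 + X z))) => Q.
  by rewrite 2!mulmxA KU mulmxDr KS0 mulmxDl mul1mx -[RHS]addr0 => /addrI.
have := Hz _ (K *m X z); rewrite KX nrm0 mulr0 => /nrm_le0 KX0.
by rewrite mulmxDr KS0 KX0 addr0.
Qed.

End Pencil.
End Deflation.

(** If the block rows of [M] with [l > d] vanish, those of [N M] vanish for [l > d - 1], and
    [B (X M) = X (N M)]; induction on [d] gives [X M = 0], and [M = 1] is reached at [d = k]. *)
Lemma Nmx_sylvester (C : numClosedFieldType) (s : nat -> nat) (k q : nat)
    (B : 'M[C]_q) (X : 'M[C]_(q, adim s k)) :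
  B \in unitmx -> B *m X = X *m Nmx s k -> X = 0.
Proof.
move=> uB BX.
have H d p (M : 'M[C]_(adim s k, p)) :
    (forall i l, label k i l -> (d < l)%N -> unit_blockrow s k i l *m M = 0) ->
    X *m M = 0.
  elim: d M => [|d IH] M HM.
    rewrite (_ : M = 0) ?mulmx0//; apply: (@unit_blockrowP C s k) => i l il.
    by rewrite mulmx0 HM//; case/and3P: il.
  rewrite -(mulKmx uB (X *m M)) (mulmxA B) BX -(mulmxA X) IH ?mulmx0// => i l il dl.
  rewrite mulmxA (unit_blockrow_Nmx _ il); case: ltnP => li; last by rewrite mul0mx.
  by rewrite HM// /label; case/and3P: il; lia.
rewrite -[X]mulmx1; apply: (H k) => i l /and3P[_ li ik] kl.
by lia.
Qed.

(** * The Riccati equation for P *)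

Section Riccati.
Context {R : realType}.
Local Notation C := R[i].
Context (s : nat -> nat) (k n q : nat) (lambda0 : C) (D : 'M[C]_n)
  (Xi Sg : forall i l : nat, 'M[C]_(n, s i)) (Xic Sgc : 'M[C]_(n, q)) (A22 : 'M[C]_q).

(** The quadratic term also carries the factor [a], which will be [t]; so the deviation from the
    Sylvester operator is [O(t)] on the unit ball. *)
Lemma riccati_subB (a : C) (A D2 : 'M[C]_q) (B D1 : 'M[C]_(adim s k))
    (D12 : 'M[C]_(adim s k, q)) (D21 X Y : 'M[C]_(q, adim s k)) :
  ((A + a *: D2) *m X - X *m (B + a *: D1) - a *: (X *m D12 *m X) + a *: D21)
  - ((A + a *: D2) *m Y - Y *m (B + a *: D1) - a *: (Y *m D12 *m Y) + a *: D21)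
  - (A *m (X - Y) - (X - Y) *m B)
  = a *: (D2 *m (X - Y) - (X - Y) *m D1 - ((X - Y) *m D12 *m X + Y *m D12 *m (X - Y))).
Proof.
rewrite ?(mulmxBl, mulmxBr, mulmxDl, mulmxDr) -?scalemxAl -?scalemxAr.
by repeat move: (_ *m _) => ?; apply/matrixP => ? ?; rewrite !mxE; ring.
Qed.

Lemma is_P_exists : ~~ eigenvalue A22 lambda0 ->
  exists P : R -> 'M[C]_(q, adim s k), is_P lambda0 D Xi Sg Xic Sgc A22 P.
Proof.
move=> eig.
have uB : A22 - lambda0%:M \in unitmx.
  by rewrite -row_free_unit -kermx_eq0; move: eig; rewrite negbK.
pose T : {linear 'M[C]_(q, adim s k) -> 'M[C]_(q, adim s k)} :=
  mulmx A22 \- mulmxr (A11 s k lambda0).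
have TE X : T X = A22 *m X - X *m A11 s k lambda0 by [].
have T_inj X : T X = 0 -> X = 0.
  rewrite TE /A11 => T0; apply: (Nmx_sylvester uB).
  move/eqP: T0; rewrite mulmxDr mul_mx_scalar opprD addrA subr_eq0 => /eqP <-.
  by rewrite mulmxBl mul_scalar_mx.
pose d11 := D11 k D Xi Sg; pose d12 := D12 k D Sg Xic.
pose d21 := D21 k D Xi Sgc; pose d22 := D22 D Xic Sgc.
pose F (t : R) X := (A22 + t%:C *: d22) *m X - X *m (A11 s k lambda0 + t%:C *: d11)
  - t%:C *: (X *m d12 *m X) + t%:C *: d21.
(* The first summand bounds the value [t d21] at 0; the others bound the Lipschitz remainder, the 2
   coming from the two quadratic terms with [X], [Y] in the unit ball. *)
pose c := nrm d21 + (nrm d22 + nrm d11 + 2 * nrm d12).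
have [||P [K HP]] := @perturbed_zero _ _ _ T F c T_inj.
- apply: filterS (near0_lt ltr01) => t /andP[t0 _].
  rewrite /F !(mulmx0, mul0mx) scaler0 !subr0 add0r nrmZ cabs_real ?(ltW t0)//.
  rewrite mulrC ler_wpM2r ?(ltW t0)// /c ler_wpDr// !addr_ge0 ?mulr_ge0 ?nrm_ge0//.
- apply: filterS (near0_lt ltr01) => t /andP[t0 _] X Y X1 Y1.
  rewrite TE /F riccati_subB.
  set W := X - Y; set r := t + nrm X + nrm Y.
  have tr : t <= r by rewrite /r -addrA lerDl addr_ge0// nrm_ge0.
  have B := bndZ (ltW t0) tr (bndD (bndD (bndM (bnd_self d22) (bnd_self W))
     (bndN (bndM (bnd_self W) (bnd_self d11))))
     (bndN (bndD (bndM (bndM (bnd_self W) (bnd_self d12)) X1)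
                 (bndM (bndM Y1 (bnd_self d12)) (bnd_self W))))).
  apply: (le_trans B); rewrite /c.
  have : 0 <= nrm d21 * r * nrm W by rewrite !mulr_ge0 ?nrm_ge0// (le_trans (ltW t0)).
  by lra.
exists P; split.
  by apply/(bigO_powP _ 1); exists K; apply: filterS HP => t []; rewrite expr1.
by apply: filterS HP => t [].
Qed.

End Riccati.

Lemma riccati_invariant (K : comPzRingType) n m q (A D : 'M[K]_n) (t : K)
    (X : 'M[K]_(n, m)) (Xc : 'M[K]_(n, q)) (a11 d11 : 'M[K]_m) (a22 d22 : 'M[K]_q)
    (d12 : 'M[K]_(m, q)) (d21 P : 'M[K]_(q, m)) :
  A *m X = X *m a11 -> A *m Xc = Xc *m a22 ->
  D *m X = X *m d11 + Xc *m d21 -> D *m Xc = X *m d12 + Xc *m d22 ->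
  (a22 + t *: d22) *m P - P *m (a11 + t *: d11) - t *: (P *m d12 *m P) + t *: d21 = 0 ->
  (A + t *: D) *m (X + Xc *m P) = (X + Xc *m P) *m (a11 + t *: (d11 + d12 *m P)).
Proof.
move=> AX AXc DX DXc ric.
have -> : (A + t *: D) *m (X + Xc *m P) =
    A *m X + A *m Xc *m P + t *: (D *m X + D *m Xc *m P).
  by rewrite mulmxDl !mulmxDr -!scalemxAl scalerDr !mulmxA.
(* The two sides differ by exactly [Xc] times the Riccati expression, which is subtracted as a
   zero. *)
rewrite AX AXc DX DXc -[LHS]subr0 -(mulmx0 _ Xc) -ric.
rewrite ?(mulmxBl, mulmxDl, mulmxDr, mulmxN) -?scalemxAl -?scalemxAr.
rewrite ?(mulmxDl, mulmxDr) -?scalemxAl -?scalemxAr ?mulmxA.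
by repeat move: (_ *m _) => ?; apply/matrixP => ? ?; rewrite !mxE; ring.
Qed.

(** * Dual bases and the invariant subspace of A + tD *)

Section DualBasis.
Context {C : numClosedFieldType} (s : nat -> nat) (k n q : nat).
Context (Xi Sg : forall i l : nat, 'M[C]_(n, s i)) (Xic Sgc : 'M[C]_(n, q)).
Hypothesis dim_eq : (adim s k + q = n)%N.
Hypothesis Xi_unit : castmx (erefl n, dim_eq) (row_mx (assemble k Xi) Xic) \in unitmx.
Hypothesis Sg_def : castmx (erefl n, dim_eq) (row_mx (assemble k Sg) Sgc)
  = (invmx (castmx (erefl n, dim_eq) (row_mx (assemble k Xi) Xic)))^t*.

Lemma dual_basis :
  assemble k Xi *m (assemble k Sg)^t* + Xic *m Sgc^t* = 1%:M.
Proof.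
have : row_mx (assemble k Xi) Xic *m (row_mx (assemble k Sg) Sgc)^t* = 1%:M.
  (* Generalizing everything whose type mentions [n] allows it to be substituted, which removes the
     casts. *)
  move: Xi_unit Sg_def; move: (dim_eq) (assemble k Xi) (assemble k Sg) Xic Sgc.
  move=> e; subst n => X S Xc Sc; rewrite !castmx_id => uX ->.
  rewrite [X in _ *m X](_ : _ = invmx (row_mx X Xc)) ?mulmxV//.
  by apply/matrixP => a b; rewrite !mxE conjCK.
by rewrite tr_row_mx map_col_mx mul_row_col.
Qed.

Lemma dual_basis_mul (D : 'M[C]_n) p (Y : 'M[C]_(n, p)) : D *m Y =
  assemble k Xi *m ((assemble k Sg)^t* *m D *m Y) + Xic *m (Sgc^t* *m D *m Y).
Proof. by rewrite -[LHS]mul1mx -dual_basis mulmxDl !mulmxA. Qed.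

Context (A D : 'M[C]_n) (lambda0 : C) (A22 : 'M[C]_q).
Hypothesis A_jordan : A *m row_mx (assemble k Xi) Xic
  = row_mx (assemble k Xi) Xic *m block_mx (A11 s k lambda0) 0 0 A22.

Lemma invariant_subspace (t : C) (P : 'M[C]_(q, adim s k)) :
    (A22 + t *: D22 D Xic Sgc) *m P - P *m (A11 s k lambda0 + t *: D11 k D Xi Sg)
      - t *: (P *m D12 k D Sg Xic *m P) + t *: D21 k D Xi Sgc = 0 ->
  (A + t *: D) *m (assemble k Xi + Xic *m P) = (assemble k Xi + Xic *m P)
    *m (A11 s k lambda0 + t *: (D11 k D Xi Sg + D12 k D Sg Xic *m P)).
Proof.
move: A_jordan; rewrite mul_mx_row mul_row_block !mulmx0 addr0 add0r.
move=> /eq_row_mx[AX AXc].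
have DX : D *m assemble k Xi =
    assemble k Xi *m D11 k D Xi Sg + Xic *m D21 k D Xi Sgc by exact: dual_basis_mul.
have DXc : D *m Xic =
    assemble k Xi *m D12 k D Sg Xic + Xic *m D22 D Xic Sgc by exact: dual_basis_mul.
exact: riccati_invariant.
Qed.

End DualBasis.

Lemma unit_blockrow_zdiagB (C : numClosedFieldType) (s : nat -> nat) (k : nat) f (a b : C) i l :
  label k i l -> unit_blockrow s k i l *m (zdiag s k f a - zdiag s k f b)
    = (a ^+ f i l - b ^+ f i l) *: unit_blockrow s k i l.
Proof.
by move=> il; rewrite mulmxBr scalerBl; congr (_ - _); exact: unit_blockrow_zdiag.
Qed.

Section OrderBlocks.
Context {R : realType}.
Local Notation C := R[i].

Lemma isO_linear m p m' p' (T : {linear 'M[C]_(m, p) -> 'M[C]_(m', p')})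
    (f : R -> 'M[C]_(m, p)) c : isO f c -> isO (fun z => T (f z)) c.
Proof.
have [a a0 Ha] := linear_bounded T.
move=> [K HK]; exists (a * K); apply: filterS HK => z Kz.
by rewrite (le_trans (Ha _))// -mulrA ler_wpM2l.
Qed.

Lemma isO_bounded m p (f : R -> 'M[C]_(m, p)) (A : 'M[C]_(m, p)) :
  isO (fun z => f z - A) 1 -> isO f 0.
Proof.
move=> Of; apply: isO_near (isOD (isO_leq (leq0n 1) Of) (isO_cst A)).
by apply: nearW => z; rewrite subrK.
Qed.

Lemma isO_mulB m n p (f : R -> 'M[C]_(m, n)) (g : R -> 'M[C]_(n, p)) A B :
  isO (fun z => f z - A) 1 -> isO (fun z => g z - B) 1 ->
  isO (fun z => f z *m g z - A *m B) 1.
Proof.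
move=> Of Og; apply: isO_near (isOD (isOM Of (isO_bounded Og)) (isOMl A Og)).
by apply: nearW => z; rewrite mulmxBl mulmxBr addrA subrK.
Qed.

Context (s : nat -> nat) (k rho : nat).
Local Notation e := (@unit_blockrow C s k).

Lemma isO_blocks p (f : R -> 'M[C]_(adim s k, p)) c :
  (forall i l, label k i l -> isO (fun z => e i l *m f z) c) -> isO f c.
Proof.
move=> H; have fE z : f z = assemble k (fun i l => (e i l)^T) *m f z.
  apply: (@unit_blockrowP C s k) => i l il; rewrite assemble_mul mulmx_sumr.
  move: i l il; apply: label_ind => i l.
  have il : label k i.+1 l.+1 by rewrite /label; have := ltn_ord i; have := ltn_ord l; lia.
  rewrite [RHS](bigD1 i)//= [X in _ + X]big1 ?addr0 => [|j ji]; last first.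
    rewrite mulmx_sumr; apply: big1 => h _.
    by rewrite mulmxA unit_blockrow_ortho ?mul0mx//; rewrite -val_eqE/= in ji; lia.
  rewrite mulmx_sumr [RHS](bigD1 l)//= [X in _ + X]big1 ?addr0 => [|h hl]; last first.
    by rewrite mulmxA unit_blockrow_ortho ?mul0mx//; rewrite -val_eqE/= in hl; lia.
  by rewrite (mulmxA _ _ (_ *m _)) unit_blockrow_id// mul1mx.
apply: (@isO_near _ _ _ (fun z => \sum_(i < k) \sum_(l < i.+1)
    (e i.+1 l.+1)^T *m (e i.+1 l.+1 *m f z))).
  by apply: nearW => z; rewrite [RHS]fE assemble_mul.
apply: isO_sum => i; apply: isO_sum => l; apply/isOMl/H.
by rewrite /label; have := ltn_ord i; have := ltn_ord l; lia.
Qed.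

(** Entries with exponent 0 are constant, also at 0 since [0 ^+ 0 = 1]; a positive power is [O(z)]
    and has limit 0. *)
Lemma isO_zdiag f : isO (fun z : R => zdiag s k f z%:C - zdiag s k f 0) 1.
Proof.
apply: isO_blocks => i l il.
apply: (@isO_near _ _ _ (fun z : R => (z%:C ^+ f i l - 0 ^+ f i l) *: e i l)).
  by apply: nearW => z; apply/esym/unit_blockrow_zdiagB.
case: (f i l) => [|d].
  by apply: isO_near (isO0 1); apply: nearW => z; rewrite !expr0 subrr scale0r.
apply: isO_near (isO_leq _ (isOZ d.+1 (isO_cst (e i l)))); last by rewrite addn0.
by apply: nearW => z; rewrite [0 ^+ d.+1]expr0n subr0.
Qed.

End OrderBlocks.

Lemma NpertB (C : numClosedFieldType) (s : nat -> nat) (k rho : nat) (a b : C)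
    (M N : 'M[C]_(adim s k)) : Npert rho a M - Npert rho b N =
  zdiag s k (pexp rho) a *m M *m zdiag s k (rexp rho) a
  - zdiag s k (pexp rho) b *m N *m zdiag s k (rexp rho) b.
Proof. by rewrite /Npert opprD addrACA subrr add0r. Qed.

Section Perturbed.
Context {R : realType}.
Local Notation C := R[i].
Context (s : nat -> nat) (k rho n q : nat).
Hypothesis rho_range : (1 <= rho <= k)%N.
Context (D : 'M[C]_n) (Xi Sg : forall i l : nat, 'M[C]_(n, s i)) (Xic : 'M[C]_(n, q)).
Hypothesis W_unit : forall i : nat, (1 <= i <= k)%N -> W k D Xi Sg i \in unitmx.
Context (P : R -> 'M[C]_(q, adim s k)).
Hypothesis OP : isO (fun z => P (z ^+ rho)) rho.

Local Notation e := (@unit_blockrow C s k).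
Local Notation PiL := (@PiL C s k rho).
Local Notation PiR := (@PiR C s k rho).
Local Notation Gmx := (Gmx k D Xi Sg rho).
Local Notation M0 := (D11 k D Xi Sg).
Local Notation stack0 := (@stack0 C s k rho).
Local Notation y0 := (PiR *m (Gmx *m stack0)).
Local Notation Theta := (Theta k D Xi Sg rho).
Local Notation middle := (@middle C s k rho).

Definition Mz (z : R) : 'M[C]_(adim s k) := M0 + D12 k D Sg Xic *m P (z ^+ rho).
Definition Uz (z : R) := Upoly k rho D Xi Sg z%:C.
Definition Vz (z : R) := Vpoly rho D Xi Sg z%:C (Mz z).

Lemma realC_neq0 (z : R) : 0 < z -> z%:C != 0 :> C.
Proof. by move=> z0; rewrite (inj_eq (@complexI R) z 0) gt_eqF. Qed.

Lemma isO_Mz : isO (fun z => Mz z - M0) 1.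
Proof.
have O : isO (fun z => D12 k D Sg Xic *m P (z ^+ rho)) 1.
  by apply/isOMl/(isO_leq _ OP); case/andP: rho_range.
by apply: isO_near O; apply: nearW => z; rewrite /Mz addrC addKr.
Qed.

Lemma isO_const_sub m p (A : 'M[C]_(m, p)) c : isO (fun z : R => A - A) c.
Proof. by apply: isO_near (isO0 c); apply: nearW => z; rewrite subrr. Qed.

Lemma isO_Uz : isO (fun z => Uz z - Upoly k rho D Xi Sg 0) 1.
Proof.
apply: isO_mulB (isO_const_sub _ 1); apply: isO_mulB (isO_const_sub _ 1).
exact: isO_mulB (isO_const_sub _ 1) (isO_zdiag _ _ _).
Qed.

Lemma isO_Vz : isO (fun z => Vz z - Vpoly rho D Xi Sg 0 M0) 1.
Proof.
apply: isO_mulB (isO_const_sub _ 1); apply: isO_mulB (isO_const_sub _ 1).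
apply: isO_mulB (isO_const_sub _ 1) _.
have O := isO_mulB (isO_mulB (isO_zdiag s k (pexp rho)) isO_Mz) (isO_zdiag s k (rexp rho)).
by apply: isO_near O; apply: nearW => z; apply/esym/NpertB.
Qed.

Lemma Theta_hatE (z : R) X1 X2 : 0 < z ->
  Theta_hat D Xi Sg Xic z%:C (P (z ^+ rho)) X1 X2 =
  middle *m (Vz z *m stack X1 X2).
Proof.
by move=> z0; rewrite /Theta_hat (VhatE rho_range _ _ _ _ _ (realC_neq0 z0)) -mulmxA.
Qed.

Lemma is_X12_exists : exists (X1 : R -> 'M[C]_(dim1 s rho, dim2 s rho))
    (X2 : R -> 'M[C]_(dim3 s k rho, dim2 s rho)), is_X12 D Xi Sg Xic P X1 X2.
Proof.
have [||||||S [OS HS]] := @pencil_solution R _ _ Uz Vz _ _ middle stack0 isO_Uz isO_Vz.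
- by move=> z; exact: middle_Upoly.
- exact: middle_Upoly.
- exact: middle_stack.
- by rewrite middle_Vpoly0// pencil_limit.
- by rewrite middle_Vpoly0// Theta_unit.
- by move=> X X0; rewrite middle_Vpoly0//; exact: pencil_injective.
exists (fun z => usubmx (usubmx (S z))), (fun z => dsubmx (S z)); split.
- apply/(bigO_powP _ 1); apply: isO_near (isO_linear (usubmx \o usubmx) OS).
  by apply: nearW => z /=; rewrite !linearB/= /stack0 /stack !col_mxKu subr0.
- apply/(bigO_powP _ 1); apply: isO_near (isO_linear dsubmx OS).
  by apply: nearW => z /=; rewrite !linearB/= /stack0 /stack !col_mxKd subr0.
apply: filterS2 (near0_lt ltr01) HS => z /andP[z0 _] [S1 SV].
rewrite (Theta_hatE _ _ z0) (UhatE _ _ _ _ _ (realC_neq0 z0)).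
by rewrite (VhatE rho_range _ _ _ _ _ (realC_neq0 z0)) stackK.
Qed.

End Perturbed.

(** * Orders of the blocks of the solution *)

Section Unscale.
Context {C : numClosedFieldType} (s : nat -> nat) (k rho : nat).
Local Notation e := (@unit_blockrow C s k).
Local Notation rx := (rexp rho).
Local Notation px := (pexp rho).
Local Notation ux := (uexp rho).

Lemma pexp_le i l : (px i l <= rho)%N.
Proof. by rewrite /pexp; case: ifP => _; [|case: ifP => _]; lia. Qed.

(** Read [rho - px i l] as the exponent of the inverse of [L]: this is [z R = L^-1 (z L R)].
    Likewise [rexpS] is the cancellation behind [L N R = N]. *)
Lemma scaling_exponents i l : label k i l ->
  (rx i l).+1 = (rho - px i l + ux i l)%N.
Proof.
case/and3P => l0 li ik; rewrite /rexp /pexp /uexp.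
case: (leqP i rho) => ir; first lia.
by case: (leqP l (i - rho)) => lr /=; lia.
Qed.

Lemma rexpS i l : label k i l -> (l < i)%N -> rx i l.+1 = (rho - px i l)%N.
Proof.
case/and3P => l0 _ ik li; rewrite /rexp /pexp.
case: (leqP i rho) => ir; first by move=> /=; lia.
by case: (leqP l (i - rho)) => lr; case: ifP => lr' /=; lia.
Qed.

(** Row [(i, l)] is multiplied by [z ^+ (rho - px i l)], which undoes [L], while [R] is absorbed
    into [Y = R y]. *)
Lemma unscale_rows (z : C) (M : 'M[C]_(adim s k)) p (y : 'M[C]_(adim s k, p))
    (Th : 'M[C]_p) :
    zdiag s k ux z *m y *m Th = Npert rho z M *m y ->
  forall i l, label k i l ->
    z *: (e i l *m (zdiag s k rx z *m y *m Th)) =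
    (if (l < i)%N then e i l.+1 *m (zdiag s k rx z *m y) else 0)
    + z ^+ rho *: (e i l *m (M *m (zdiag s k rx z *m y))).
Proof.
move=> eqy i l il.
have row f : e i l *m (zdiag s k f z *m y *m Th) = z ^+ f i l *: (e i l *m y *m Th).
  by rewrite mulmxA unit_blockrow_zdiag_mul// -scalemxAl.
rewrite row scalerA -exprS scaling_exponents// exprD -scalerA -row eqy.
rewrite unit_blockrow_Npert// scalerDr scalerA -exprD subnK ?pexp_le//.
congr (_ + _); case: ltnP => li; last by rewrite scaler0.
by rewrite -rexpS// -unit_blockrow_zdiag_mul// /label; case/and3P: il; lia.
Qed.

Lemma invariant_of_rows (z : C) (M : 'M[C]_(adim s k)) p (Y : 'M[C]_(adim s k, p))
    (Th : 'M[C]_p) (lambda0 : C) :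
    (forall i l, label k i l -> z *: (e i l *m (Y *m Th)) =
      (if (l < i)%N then e i l.+1 *m Y else 0) + z ^+ rho *: (e i l *m (M *m Y))) ->
  (A11 s k lambda0 + z ^+ rho *: M) *m Y = Y *m (lambda0%:M + z *: Th).
Proof.
move=> H; have NY : (Nmx s k + z ^+ rho *: M) *m Y = z *: (Y *m Th).
  apply: (@unit_blockrowP C s k) => i l il; rewrite -[RHS]scalemxAr H//.
  rewrite mulmxDl mulmxDr mulmxA (unit_blockrow_Nmx _ il) -scalemxAl -scalemxAr.
  by congr (_ + _); case: ifP; rewrite ?mul0mx.
by rewrite /A11 -addrA mulmxDl NY mul_scalar_mx mulmxDr mul_mx_scalar scalemxAr.
Qed.

End Unscale.

Lemma unscale (C : numClosedFieldType) (s : nat -> nat) (k rho n q : nat)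
    (D : 'M[C]_n) (Xi Sg : forall i l : nat, 'M[C]_(n, s i)) (Xic : 'M[C]_(n, q))
    (z : C) (P : 'M[C]_(q, adim s k)) p (S : 'M[C]_(dimUV s k rho, p)) (Th : 'M[C]_p) :
    (1 <= rho <= k)%N -> z != 0 ->
    Uhat k D Xi Sg rho z *m S *m Th = Vhat D Xi Sg Xic rho z P *m S ->
  zdiag s k (uexp rho) z *m (PiR s k rho *m (Gmx k D Xi Sg rho *m S)) *m Th =
  Npert rho z (D11 k D Xi Sg + D12 k D Sg Xic *m P)
    *m (PiR s k rho *m (Gmx k D Xi Sg rho *m S)).
Proof.
move=> rho_range z0; rewrite (UhatE _ _ _ _ _ z0).
rewrite (VhatE rho_range _ _ _ _ _ z0).
rewrite UpolyS VpolyS.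
rewrite -(mulmxA (PiL s k rho)).
exact: PiL_inj.
Qed.

Section Solution.
Context {R : realType}.
Local Notation C := R[i].
Context (s : nat -> nat) (k rho n q : nat).
Hypothesis rho_range : (1 <= rho <= k)%N.
Context (D : 'M[C]_n) (Xi Sg : forall i l : nat, 'M[C]_(n, s i)) (Xic : 'M[C]_(n, q)).
Hypothesis W_unit : forall i : nat, (1 <= i <= k)%N -> W k D Xi Sg i \in unitmx.
Context (P : R -> 'M[C]_(q, adim s k)).
Hypothesis OP : isO (fun z => P (z ^+ rho)) rho.
Context (X1 : R -> 'M[C]_(dim1 s rho, dim2 s rho))
        (X2 : R -> 'M[C]_(dim3 s k rho, dim2 s rho)).
Hypothesis HX : is_X12 D Xi Sg Xic P X1 X2.

Local Notation e := (@unit_blockrow C s k).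
Local Notation PiL := (@PiL C s k rho).
Local Notation PiR := (@PiR C s k rho).
Local Notation Gmx := (Gmx k D Xi Sg rho).
Local Notation M0 := (D11 k D Xi Sg).
Local Notation stack0 := (@stack0 C s k rho).
Local Notation y0 := (PiR *m (Gmx *m stack0)).
Local Notation Theta := (Theta k D Xi Sg rho).
Local Notation middle := (@middle C s k rho).
Local Notation Mz := (Mz rho D Xi Sg Xic P).
Local Notation Vz := (Vz rho D Xi Sg Xic P).
Local Notation id_blockrow := (@id_blockrow C s rho).

Definition Sz (z : R) : 'M[C]_(dimUV s k rho, dim2 s rho) := stack (X1 z) (X2 z).
Definition Thz (z : R) : 'M[C]_(dim2 s rho) :=
  Theta_hat D Xi Sg Xic z%:C (P (z ^+ rho)) (X1 z) (X2 z).
Definition yz (z : R) := PiR *m (Gmx *m Sz z).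
Definition Yz (z : R) := zdiag s k (rexp rho) z%:C *m yz z.
Definition Ylim := zdiag s k (rexp rho) 0 *m y0.

Lemma stackB (A1 B1 : 'M[C]_(dim1 s rho, dim2 s rho)) (A2 B2 : 'M[C]_(dim3 s k rho, dim2 s rho)) :
  stack A1 A2 - stack B1 B2 = col_mx (col_mx 1%:M 0) 0 *m (A1 - B1) + col_mx 0 1%:M *m (A2 - B2).
Proof.
rewrite /stack opp_col_mx opp_col_mx !add_col_mx subrr !mul_col_mx !mul0mx !mul1mx.
by rewrite add_col_mx addr0 add0r.
Qed.

Lemma isO_Sz : isO (fun z => Sz z - stack0) 1.
Proof.
case: HX => /(bigO_powP _ 1) O1 /(bigO_powP _ 1) O2 _.
have O := isOD (isOMl (col_mx (col_mx 1%:M 0) 0 : 'M[C]_(dimUV s k rho, _)) O1)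
               (isOMl (col_mx 0 1%:M : 'M[C]_(dimUV s k rho, _)) O2).
by apply: isO_near O; apply: nearW => z; rewrite /Sz /stack0 stackB !subr0.
Qed.

Lemma isO_yz : isO (fun z => yz z - y0) 1.
Proof.
apply: isO_mulB (isO_const_sub _ 1) _; exact: isO_mulB (isO_const_sub _ 1) isO_Sz.
Qed.

Lemma isO_Yz : isO (fun z => Yz z - Ylim) 1.
Proof. exact: isO_mulB (isO_zdiag _ _ _) isO_yz. Qed.

Lemma isO_Thz : isO (fun z => Thz z - Theta) 1.
Proof.
have O := isO_mulB (isO_const_sub middle 1)
  (isO_mulB (isO_Vz rho_range D Xi Sg Xic OP) isO_Sz).
apply: isO_near O; apply: filterS (near0_lt ltr01) => z /andP[z0 _].
have -> : middle *m (Vz z *m Sz z) = Thz z by apply/esym; exact: Theta_hatE.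
by rewrite middle_Vpoly0.
Qed.

(** These blocks are exact, not merely known up to [O(z)]; this yields the exact formula for the
    block with index [rho]. *)
Lemma yz_eq z (l : 'I_rho) : e rho l.+1 *m yz z = id_blockrow l.
Proof.
have := middle_stack (X1 z) (X2 z); rewrite (middle_coord rho_range D Xi Sg).
by move/(congr1 (fun A => submxcol A l)); rewrite mxcolK.
Qed.

Lemma Yz_rows : \forall z \near 0^'+, forall i l, label k i l ->
  z%:C *: (e i l *m (Yz z *m Thz z)) =
  (if (l < i)%N then e i l.+1 *m Yz z else 0)
  + z%:C ^+ rho *: (e i l *m (Mz z *m Yz z)).
Proof.
case: HX => _ _; apply: filterS2 (near0_lt ltr01) => z /andP[z0 _].
by move=> /(unscale rho_range (realC_neq0 z0)); exact: unscale_rows.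
Qed.

Lemma Ylim_lt i l : label k i l -> (i < rho)%N -> e i l *m Ylim = 0.
Proof. by move=> il ir; rewrite unit_blockrow_zdiag_mul// y0_lt// scaler0. Qed.

Lemma Ylim_rest i l : label k i l -> (rho < i)%N -> (1 < l)%N -> e i l *m Ylim = 0.
Proof. by move=> il ir l1; rewrite unit_blockrow_zdiag_mul// y0_rest// scaler0. Qed.

Lemma isO_M_Yz i l : isO (fun z => z%:C ^+ rho *: (e i l *m (Mz z *m Yz z))) rho.
Proof.
have O := isOZ rho (isOMl (e i l) (isOM (isO_bounded (isO_Mz rho_range D Xi Sg Xic OP))
  (isO_bounded isO_Yz))).
by rewrite !addn0 in O.
Qed.

(** At [l = i] the equation reads [z Y_{ii} Theta_hat = O(z^rho)]. Each step down divides by [z] and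
    cancels [Theta_hat], so it costs one power. *)
Lemma isO_Yz_lt i l : label k i l -> (i < rho)%N ->
  isO (fun z => e i l *m Yz z) (rho - (i - l).+1).
Proof.
move=> il ir; have [m lm] : exists m, (i - l = m)%N by exists (i - l)%N.
have step j c : label k i j -> (c < rho)%N ->
    ((j < i)%N -> isO (fun z => e i j.+1 *m Yz z) c.+1) ->
    isO (fun z => e i j *m Yz z) c.
  move=> ij cr O; apply: (isO_unit_cancel (Theta_unit rho_range W_unit) isO_Thz).
  apply: (@isOZ_inv _ _ _ _ _ 1); rewrite add1n.
  have OM := isO_leq cr (isO_M_Yz i j).
  have [ji|ji] := ltnP j i.
    apply: isO_near (isOD (O ji) OM); apply: filterS Yz_rows => z /(_ i j ij).
    by rewrite ji expr1 mulmxA => ->.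
  apply: isO_near OM; apply: filterS Yz_rows => z /(_ i j ij).
  by rewrite ltnNge ji add0r expr1 mulmxA => ->.
rewrite lm; elim: m l lm il => [|m IH] l lm il; apply: step => //; try lia.
move=> li; rewrite (_ : (rho - m.+2).+1 = rho - m.+1)%N; last by case/and3P: il; lia.
by apply: IH; [lia | rewrite /label; case/and3P: il; lia].
Qed.

(** Solving the row equation for [Y_{i,l+1}] gains one power of [z] per step, until the perturbation
    term caps the order at [rho]. *)
Lemma isO_Yz_gt i l : label k i l.+1 -> isO (fun z => e i l.+1 *m Yz z) (minn l rho).
Proof.
elim: l => [_|l IH il]; first by rewrite min0n; exact/isOMl/(isO_bounded isO_Yz).
have il' : label k i l.+1 by rewrite /label; case/and3P: il; lia.
have O1 := isOZ 1 (isOM (IH il') (isO_bounded isO_Thz)).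
have O2 := isOB (isO_leq _ O1) (isO_leq _ (isO_M_Yz i l.+1)).
apply: isO_near (O2 (minn l.+1 rho) _ _); try lia.
apply: filterS Yz_rows => z /(_ i l.+1 il').
by rewrite expr1 (mulmxA (e i l.+1)) => ->; rewrite ifT ?addrK//; case/and3P: il.
Qed.

Lemma leading_termE : leading_term k D Xi Sg rho = assemble k Xi *m Ylim.
Proof.
rewrite /Ylim (assemble_y0 rho_range) id_blockrow_mxrow /leading_term mul_row_col.
rewrite /lead mulmxDl -mulmxA; congr (_ *m _ + _ *m _).
by rewrite mul_mxrow; apply: eq_mxrow => l; case: ifP; rewrite ?mulmx1 ?mulmx0.
Qed.

(** [Ylim] is subtracted because [assemble k Xi *m Ylim] is the leading term. *)
Definition Xblock (i : nat) (z : R) : 'M[C]_(jdim s i, dim2 s rho) :=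
  \mxcol_(l < i) (e i l.+1 *m (Yz z - Ylim)).

Lemma Xblock_sum z : assemble k Xi *m Yz z =
  leading_term k D Xi Sg rho + \sum_(i < k) blockrow Xi i.+1 *m Xblock i.+1 z.
Proof.
rewrite leading_termE /Xblock; move: (Yz z) Ylim => Y Y0.
rewrite -[in LHS](subrKC Y0 Y) mulmxDr; congr (_ + _).
rewrite assemble_mul; apply: eq_bigr => i _.
by rewrite /blockrow mul_mxrow_mxcol.
Qed.

Lemma Xblock_eq z : Xblock rho z = \mxdiag_(l < rho)
  ((if l == 0%N :> nat then 0 else (z ^+ l)%:C)%:M : 'M[C]_(s rho)).
Proof.
rewrite -[RHS]mulmx1 -[X in _ = _ *m X]submxcolK mul_mxdiag_mxcol.
apply: eq_mxcol => l; have il : label k rho l.+1 by rewrite /label; have := ltn_ord l; lia.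
have EY : e rho l.+1 *m Yz z = z%:C ^+ l *: id_blockrow l.
  by rewrite unit_blockrow_zdiag_mul// yz_eq /rexp leqnn.
have EL : e rho l.+1 *m Ylim = 0 ^+ l *: id_blockrow l.
  apply: etrans (unit_blockrow_zdiag_mul _ _ _ il) _.
  by rewrite /rexp leqnn; congr (_ *: _); exact: y0_eq.
rewrite mulmxBr; apply: etrans (f_equal2 +%R EY (congr1 -%R EL)) _.
rewrite -scalerBl mul_scalar_mx -/(id_blockrow l); congr (_ *: _).
(* For [l = 0] the identity block already sits in [Ylim]; for [l > 0] the block of [Ylim] is zero
   and the full power of [z] remains. *)
case: (l : nat) => [|d]; first by rewrite !expr0 subrr.
by rewrite [0 ^+ d.+1]expr0n subr0 rmorphXn.
Qed.

Lemma Xblock_row i (l : 'I_i) z :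
  submxcol (Xblock i z) l = e i l.+1 *m Yz z - e i l.+1 *m Ylim.
Proof. by rewrite mxcolK mulmxBr. Qed.

Lemma isO_Xblock_lt i (l : 'I_i) : (i < rho)%N ->
  isO (fun z => submxcol (Xblock i z) l) (rho - (i - l)).
Proof.
move=> ir; have il : label k i l.+1 by rewrite /label; have := ltn_ord l; lia.
have := isO_Yz_lt il ir; rewrite subnSK//; apply: isO_near.
apply: nearW => z; rewrite Xblock_row; apply: etrans (esym (subr0 _)) _.
by congr (_ - _); rewrite Ylim_lt.
Qed.

Lemma isO_Xblock_gt i (l : 'I_i) : (rho < i <= k)%N ->
  isO (fun z => submxcol (Xblock i z) l) (if l == 0%N :> nat then 1 else minn l rho).
Proof.
case/andP => ir ik; have il : label k i l.+1 by rewrite /label; have := ltn_ord l; lia.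
case: eqVneq => l0.
  apply: isO_near (isOMl (e i l.+1) isO_Yz).
  by apply: nearW => z; rewrite Xblock_row mulmxBr.
apply: isO_near (isO_Yz_gt il).
apply: nearW => z; rewrite Xblock_row; apply: etrans (esym (subr0 _)) _.
by congr (_ - _); rewrite Ylim_rest//; lia.
Qed.

End Solution.

Theorem theorem2 (R : realType) (n q k : nat) (s : nat -> nat)
  (A D : 'M[R[i]]_n) (lambda0 : R[i])
  (Xi Sg : forall i l : nat, 'M[R[i]]_(n, s i)) (Xic Sgc : 'M[R[i]]_(n, q))
  (A22 : 'M[R[i]]_q)
  (sk_gt0 : (0 < s k)%N)
  (dim_eq : (adim s k + q = n)%N)
  (Xi_unit : castmx (erefl n, dim_eq) (row_mx (assemble k Xi) Xic) \in unitmx)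
  (Sg_def : castmx (erefl n, dim_eq) (row_mx (assemble k Sg) Sgc)
    = (invmx (castmx (erefl n, dim_eq) (row_mx (assemble k Xi) Xic)))^t*)
  (A_jordan : A *m row_mx (assemble k Xi) Xic
    = row_mx (assemble k Xi) Xic *m block_mx (A11 s k lambda0) 0 0 A22)
  (lambda0_A22 : ~~ eigenvalue A22 lambda0)
  (W_unit : forall i : nat, (1 <= i <= k)%N -> W k D Xi Sg i \in unitmx)
  (rho : nat) (rho_range : (1 <= rho <= k)%N) :
  (exists P : R -> 'M[R[i]]_(q, adim s k),
     is_P lambda0 D Xi Sg Xic Sgc A22 P) /\
  forall P : R -> 'M[R[i]]_(q, adim s k),
  is_P lambda0 D Xi Sg Xic Sgc A22 P ->
  (exists (X1 : R -> 'M[R[i]]_(dim1 s rho, dim2 s rho))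
          (X2 : R -> 'M[R[i]]_(dim3 s k rho, dim2 s rho)),
     is_X12 D Xi Sg Xic P X1 X2) /\
  forall (X1 : R -> 'M[R[i]]_(dim1 s rho, dim2 s rho))
         (X2 : R -> 'M[R[i]]_(dim3 s k rho, dim2 s rho)),
  is_X12 D Xi Sg Xic P X1 X2 ->
  let root (t : R) : R := t `^ (rho%:R^-1) in
  let Th (t : R) : 'M[R[i]]_(dim2 s rho) :=
    let z := root t in
    Theta_hat D Xi Sg Xic z%:C (P (z ^+ rho)) (X1 z) (X2 z) in
  bigO_pow (fun t => Th t - Theta k D Xi Sg rho) (rho%:R^-1) /\
  exists (X : R -> 'M[R[i]]_(n, dim2 s rho))
         (Xt : forall i : nat, R -> 'M[R[i]]_(jdim s i, dim2 s rho))
         (E : R -> 'M[R[i]]_(n, dim2 s rho)),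
    [/\ \forall t \near 0^'+,
          (A + t%:C *: D) *m X t = X t *m (lambda0%:M + (root t)%:C *: Th t),
        \forall t \near 0^'+,
          X t = leading_term k D Xi Sg rho
                + \sum_(i < k) blockrow Xi i.+1 *m Xt i.+1 t + E t
          /\ Xt rho t = \mxdiag_(l < rho)
               ((if l == 0%N :> nat then 0 else (t `^ (l%:R / rho%:R))%:C)%:M
                 : 'M[R[i]]_(s rho)),
        bigO_pow E 1,
        forall (i : nat) (l : 'I_i), (1 <= i <= rho.-1)%N ->
          bigO_pow (fun t => submxcol (Xt i t) l) (1 - (i - l)%:R / rho%:R)
      & forall (i : nat) (l : 'I_i), (rho.+1 <= i <= k)%N ->
          bigO_pow (fun t => submxcol (Xt i t) l)
            ((if l == 0%N :> nat then 1%N else minn l rho)%:R / rho%:R)].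
Proof.
have rho_gt0 : (0 < rho)%N by case/andP: rho_range.
split=> [|P HP]; first exact: is_P_exists.
have OP : isO (fun z => P (z ^+ rho)) rho.
  by case: HP => /(bigO_powP _ 1) O _; exact: isO_expr.
split=> [|X1 X2 HX root Th]; first exact: is_X12_exists.
split.
  by have := isO_root rho_gt0 (isO_Thz rho_range OP HX); rewrite mul1r.
pose Y := Yz D Xi Sg X1 X2.
pose Xb := Xblock D Xi Sg X1 X2.
(* The part of this matrix in the range of [Xic] is the remainder [E]; it is [O(z^rho)], that is
   [O(t)], because [P] has this order and [Y] is bounded. *)
exists (fun t => (assemble k Xi + Xic *m P (root t ^+ rho)) *m Y (root t)).
exists (fun i t => Xb i (root t)).
exists (fun t => Xic *m (P (root t ^+ rho) *m Y (root t))).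
split.
- have H : \forall z \near 0^'+, (A + (z ^+ rho)%:C *: D)
      *m ((assemble k Xi + Xic *m P (z ^+ rho)) *m Y z) =
      (assemble k Xi + Xic *m P (z ^+ rho)) *m Y z
      *m (lambda0%:M + z%:C *: Thz D Xi Sg Xic P X1 X2 z).
    have Prow := near0_expr rho_gt0 HP.2.
    apply: filterS2 Prow (Yz_rows rho_range HX) => z Pz Yrow.
    rewrite mulmxA (invariant_subspace Xi_unit Sg_def A_jordan Pz).
    rewrite -2!(mulmxA (_ + _)); congr (_ *m _).
    by rewrite rmorphXn; exact: invariant_of_rows.
  apply: filterS2 (near0_lt ltr01) (near0_root rho_gt0 H) => t /andP[t0 _].
  by rewrite -/(root t) {1}/root rootK// ltW.
- apply: filterS (near0_lt ltr01) => t /andP[t0 _]; split.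
    by rewrite mulmxDl -mulmxA (Xblock_sum rho_range).
  rewrite /Xb (Xblock_eq rho_range); apply: eq_mxdiag => l.
  by rewrite powR_root.
- have O := isOMl Xic (isOM OP (isO_bounded (isO_Yz HX))).
  have := isO_root rho_gt0 O; rewrite addn0 mulfV ?pnatr_eq0 -?lt0n//.
- move=> i l /andP[i0 ir]; have ir' : (i < rho)%N by lia.
  have := isO_root rho_gt0 (isO_Xblock_lt rho_range W_unit OP HX l ir').
  rewrite natrB; last by lia.
  by rewrite mulrBl mulfV// pnatr_eq0 -lt0n.
- move=> i l ir.
  exact: isO_root rho_gt0 (isO_Xblock_gt rho_range OP HX l ir).
Qed.
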